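(* Let $\Bbbk$ be a field, $H$ a Hopf algebra over $\Bbbk$, $R$ a Hopf algebra in ${}^H_H\mathcal{YD}$ and $\mathcal{H}=R\#H$. The maps $$\Phi:Z(R)\to Z'(\mathcal{H}),\qquad \Phi(\pi)(r\otimes h,r'\otimes h')=\pi(r,h\cdot r')\,\varepsilon_H(h'),$$ $$\Psi:\mathrm{C}(R)\to\mathrm{C}'(\mathcal{H}),\qquad \Psi([(\mathcal{E},\gamma)])=[(\mathcal{E}\#H,\gamma\otimes\mathrm{id})],$$ for all $\pi\in Z(R)$, $r,r'\in R$, $h,h'\in H$, $[(\mathcal{E},\gamma)]\in\mathrm{C}(R)$, are well defined bijections. Moreover, $\Psi\circ\alpha_R=\alpha_{\mathcal{H}}\circ\Phi$ as maps $Z(R)\to\mathrm{C}'(\mathcal{H})$.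
   Context: Conventions. ${}^H_H\mathcal{YD}$ is the category of left-left Yetter-Drinfeld modules over $H$, with coaction written $x\mapsto x_{(-1)}\otimes x_{(0)}$ and braiding $x\otimes y\mapsto x_{(-1)}\cdot y\otimes x_{(0)}$; the formula also makes sense for $x$ in a Yetter-Drinfeld module and $y$ in a left $H$-module. $\mathcal{H}=R\#H$ is the (ordinary) Hopf algebra on $R\otimes H$ with $(r\otimes h)(r'\otimes h')=r(h_{(1)}\cdot r')\otimes h_{(2)}h'$ and $\Delta(r\otimes h)=(r_{(1)}\otimes r_{(2)(-1)}h_{(1)})\otimes(r_{(2)(0)}\otimes h_{(2)})$. Objects over $R$. $R\otimes R$ is a coalgebra with $\Delta(r\otimes s)=(r_{(1)}\otimes r_{(2)(-1)}\cdot s_{(1)})\otimes(r_{(2)(0)}\otimes s_{(2)})$ and counit $\varepsilon_R\otimes\varepsilon_R$. $Z(R)$ is the set of $H$-module morphisms $\pi:R\otimes R\to\Bbbk$ that are convolution invertible for this coalgebra structure (with inverse an $H$-module morphism) and satisfy $\pi(1,1)=1$ and $\pi(r_{(1)},r_{(2)(-1)}\cdot s_{(1)})\,\pi(r_{(2)(0)}s_{(2)},t)=\pi(s_{(1)},s_{(2)(-1)}\cdot t_{(1)})\,\pi(r,s_{(2)(0)}t_{(2)})$ for all $r,s,t\in R$. An $R$-cleft object in $H$-mod is a left $H$-module algebra $\mathcal{E}$ with an $H$-linear right $R$-comodule structure $\rho_{\mathcal{E}}:\mathcal{E}\to\mathcal{E}\otimes R$, $e\mapsto e_{(0)}\otimes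 e_{(1)}$, that is an algebra morphism for the product $(e\otimes r)(e'\otimes r')=e(r_{(-1)}\cdot e')\otimes r_{(0)}r'$ on $\mathcal{E}\otimes R$, such that $\{e\in\mathcal{E}:\rho_{\mathcal{E}}(e)=e\otimes1\}=\Bbbk1$ and such that there is a section, i.e. an $H$-linear right $R$-comodule morphism $\gamma:R\to\mathcal{E}$ that is convolution invertible with $H$-linear inverse. Sections are normalized: $\gamma(1)=1$. $\mathrm{C}(R)$ is the set of isomorphism classes $[(\mathcal{E},\gamma)]$ of pairs of an $R$-cleft object in $H$-mod and a section; an isomorphism $(\mathcal{E},\gamma)\to(\mathcal{E}',\gamma')$ is an $H$-linear, $R$-colinear algebra isomorphism $f$ with $f\gamma=\gamma'$. The bijection $\alpha_R:Z(R)\to\mathrm{C}(R)$ sends $\pi$ to $[(\Bbbk\#_\pi R,\mathrm{id}_R)]$, where $\Bbbk\#_\pi R$ is $R$ as $H$-module and as $R$-comodule (via $\Delta_R$), with multiplication $r\cdot_\pi s=\pi(r_{(1)},r_{(2)(-1)}\cdot s_{(1)})\,r_{(2)(0)}s_{(2)}$ and unit $1$. Objects over $\mathcal{H}$. $Z(\mathcal{H})$ is the set of classical two-cocycles: convolution invertible linear maps $\sigma:\mathcal{H}\otimes\mathcal{H}\to\Bbbk$ with $\sigma(1,1)=1$ and $\sigma(x_{(1)},y_{(1)})\sigma(x_{(2)}y_{(2)},z)=\sigma(y_{(1)},z_{(1)})\sigma(x,y_{(2)}z_{(2)})$. $Z'(\mathcal{H})$ is the set of $\sigma\in Z(\mathcal{H})$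 with $\sigma(r\otimes h,r'\otimes h')=\sigma(r\otimes1,h\cdot r'\otimes1)\varepsilon_H(h')$ for all $r,r'\in R$, $h,h'\in H$. An $\mathcal{H}$-cleft object is a right $\mathcal{H}$-comodule algebra $E$ over $\Bbbk$ with coinvariants $\Bbbk1$ admitting a section, i.e. a convolution invertible $\mathcal{H}$-comodule map $\gamma:\mathcal{H}\to E$, again normalized by $\gamma(1)=1$. $\mathrm{C}(\mathcal{H})$ is the set of isomorphism classes $[(E,\gamma)]$ of pairs of an $\mathcal{H}$-cleft object and a section (isomorphisms: comodule algebra isomorphisms compatible with the sections). $\mathrm{C}'(\mathcal{H})$ is the set of $[(E,\gamma)]\in\mathrm{C}(\mathcal{H})$ with $\gamma((1\otimes h)(r\otimes h')(1\otimes h''))=\gamma(1\otimes h)\gamma(r\otimes h')\gamma(1\otimes h'')$ for all $r\in R$, $h,h',h''\in H$ (independent of the representative). The bijection $\alpha_{\mathcal{H}}:Z(\mathcal{H})\to\mathrm{C}(\mathcal{H})$ sends $\sigma$ to $[(\Bbbk\#_\sigma\mathcal{H},\mathrm{id}_{\mathcal{H}})]$, where $\Bbbk\#_\sigma\mathcal{H}$ is $\mathcal{H}$ as comodule, with multiplication $x\cdot_\sigma y=\sigma(x_{(1)},y_{(1)})x_{(2)}y_{(2)}$. $\mathcal{E}\#H$ is the smash product algebra on $\mathcal{E}\otimes H$, $(e\otimes h)(e'\otimes h')=e(h_{(1)}\cdot e')\otimes h_{(2)}h'$, with $\mathcal{H}$-coaction $e\otimes h\mapsto(e_{(0)}\otimes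 e_{(1)(-1)}h_{(1)})\otimes(e_{(1)(0)}\otimes h_{(2)})$. *)

(* Defs.v *)
From HB Require Import structures.
From mathcomp Require Import all_boot all_order all_algebra.
From mathcomp Require Import boolp.

Set Implicit Arguments.
Unset Strict Implicit.
Unset Printing Implicit Defensive.

Import GRing.Theory.
Local Open Scope quotient_scope.
Local Open Scope ring_scope.

(* Tensor product of two vector spaces: finite lists of pairs (v, w), read as
   formal sums of the v ⊗ w, two lists being identified when all bilinear maps
   give them the same value.  [tens_bilin], [tens_sum], [tliftE] and
   [tlift_linear] below are the usual universal property. *)

Definition bilin (k : fieldType) (V W U : lmodType k) (f : V -> W -> U) : Prop :=
  (forall w, linear (f^~ w)) /\ (forall v, linear (f v)).

Section Tensor.
Variables (k : fieldType) (V W : lmodType k).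

Definition tequiv (s t : seq (V * W)) : bool :=
  `[< forall (U : lmodType k) (f : V -> W -> U), bilin f ->
      \sum_(p <- s) f p.1 p.2 = \sum_(p <- t) f p.1 p.2 >].

Lemma tequiv_refl : reflexive tequiv.
Proof. by move=> s; apply/asboolP. Qed.

Lemma tequiv_sym : symmetric tequiv.
Proof.
by move=> s t; apply/asboolP/asboolP => h U f bf; rewrite (h U f bf).
Qed.

Lemma tequiv_trans : transitive tequiv.
Proof.
move=> t s u /asboolP h1 /asboolP h2; apply/asboolP => U f bf.
by rewrite (h1 U f bf) (h2 U f bf).
Qed.

Canonical tequiv_equiv := EquivRel tequiv tequiv_refl tequiv_sym tequiv_trans.

Definition tensor : Type := {eq_quot tequiv}.

HB.instance Definition _ := Choice.on tensor.
HB.instance Definition _ := EqQuotient.on tensor.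

(* The Sweedler sum  Σ f(v, w)  over t = Σ v ⊗ w.  It is computed on a chosen
   representative; for bilinear f the choice is irrelevant (tliftE). *)
Definition tlift (U : nmodType) (f : V -> W -> U) (t : tensor) : U :=
  \sum_(p <- repr t) f p.1 p.2.

Lemma tlift_pi (U : lmodType k) (f : V -> W -> U) s : bilin f ->
  tlift f (\pi_tensor s) = \sum_(p <- s) f p.1 p.2.
Proof.
move=> bf; have /eqquotP/asboolP h : repr (\pi_tensor s) = s %[mod tensor].
  by rewrite reprK.
exact: (h U f bf).
Qed.

Lemma tensor_ext (x y : tensor) :
  (forall (U : lmodType k) (f : V -> W -> U), bilin f -> tlift f x = tlift f y) ->
  x = y.
Proof.
move=> h; rewrite -[x]reprK -[y]reprK; apply/eqquotP/asboolP => U f bf.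
exact: h.
Qed.

Definition tens (v : V) (w : W) : tensor := \pi_tensor [:: (v, w)].
Definition tens0 : tensor := \pi_tensor [::].
Definition tensD (x y : tensor) : tensor := \pi_tensor (repr x ++ repr y).
Definition tensZ (a : k) (x : tensor) : tensor :=
  \pi_tensor [seq (a *: p.1, p.2) | p <- repr x].
Definition tensN (x : tensor) : tensor := tensZ (-1) x.

Section Lift.
Variables (U : lmodType k) (f : V -> W -> U) (bf : bilin f).

Lemma tliftE v w : tlift f (tens v w) = f v w.
Proof. by rewrite tlift_pi // big_seq1. Qed.

Lemma tlift0 : tlift f tens0 = 0.
Proof. by rewrite tlift_pi // big_nil. Qed.

Lemma tliftD x y : tlift f (tensD x y) = tlift f x + tlift f y.
Proof. by rewrite tlift_pi // big_cat. Qed.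

Lemma tliftZ a x : tlift f (tensZ a x) = a *: tlift f x.
Proof.
rewrite tlift_pi // big_map scaler_sumr; apply: eq_bigr => p _ /=.
have h0 : f 0 p.2 = 0.
  by have := bf.1 p.2 (-1) 0 0; rewrite scaler0 addr0 scaleN1r addNr.
by have := bf.1 p.2 a p.1 0; rewrite !addr0 h0 addr0.
Qed.

Lemma tliftN x : tlift f (tensN x) = - tlift f x.
Proof. by rewrite tliftZ scaleN1r. Qed.

End Lift.

Let tlE := (tlift0, tliftD, tliftN, tliftZ).

Fact tensDA : associative tensD.
Proof. by move=> x y z; apply: tensor_ext => U f bf; rewrite !tlE // addrA. Qed.
Fact tensDC : commutative tensD.
Proof. by move=> x y; apply: tensor_ext => U f bf; rewrite !tlE // addrC. Qed.
Fact tens0D : left_id tens0 tensD.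
Proof. by move=> x; apply: tensor_ext => U f bf; rewrite !tlE // add0r. Qed.
Fact tensND : left_inverse tens0 tensN tensD.
Proof. by move=> x; apply: tensor_ext => U f bf; rewrite !tlE // addNr. Qed.

HB.instance Definition _ := GRing.isZmodule.Build tensor
  tensDA tensDC tens0D tensND.

Fact tensZA a b x : tensZ a (tensZ b x) = tensZ (a * b) x.
Proof. by apply: tensor_ext => U f bf; rewrite !tlE // scalerA. Qed.
Fact tensZ1 : left_id 1 tensZ.
Proof. by move=> x; apply: tensor_ext => U f bf; rewrite !tlE // scale1r. Qed.
Fact tensZDr : right_distributive tensZ +%R.
Proof. by move=> a x y; apply: tensor_ext => U f bf; rewrite !tlE // scalerDr. Qed.
Fact tensZDl x : {morph tensZ^~ x : a b / a + b}.
Proof. by move=> a b; apply: tensor_ext => U f bf; rewrite !tlE // scalerDl. Qed.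

HB.instance Definition _ := GRing.Zmodule_isLmodule.Build k tensor
  tensZA tensZ1 tensZDr tensZDl.

Lemma tlift_linear (U : lmodType k) (f : V -> W -> U) : bilin f ->
  linear (tlift f).
Proof. by move=> bf a x y; rewrite (tliftD bf) (tliftZ bf). Qed.

Lemma tens_bilin : bilin tens.
Proof.
split=> [w a v v'|v a w w']; apply: tensor_ext => U f bf;
  rewrite (tliftD bf) (tliftZ bf) !tliftE //; [exact: bf.1|exact: bf.2].
Qed.

Lemma tens_sum (t : tensor) : t = \sum_(p <- repr t) tens p.1 p.2.
Proof.
apply: tensor_ext => U f bf; rewrite {1}/tlift.
elim: (repr t) => [|p s IH]; first by rewrite !big_nil (tlift0 bf).
by rewrite !big_cons (tliftD bf) tliftE // IH.
Qed.

Lemma tens_ind (P : tensor -> Prop) :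
  P 0 -> (forall v w t, P t -> P (tens v w + t)) -> forall t, P t.
Proof.
move=> P0 PD t; rewrite (tens_sum t).
by elim: (repr t) => [|p s IH]; rewrite ?big_nil ?big_cons //; apply: PD.
Qed.

End Tensor.

Arguments tens {k V W} v w.
Arguments tlift {k V W U} f t.

Notation "V ⊗ W" := (tensor V W) (at level 40, left associativity) : type_scope.
Notation "v ⊗ w" := (tens v w) (at level 40, left associativity) : ring_scope.
Notation "\tsum_ ( v ⊗ w <- t ) F" := (tlift (fun v w => F) t)
  (at level 41, v name, w name, t at level 39, F at level 41, right associativity,
   format "\tsum_ ( v  ⊗  w  <-  t )  F") : ring_scope.

Section Structures.
Variable k : fieldType.

(* one != 0: the coinvariants k1 of a cleft object are a copy of k, so the zero
   algebra is excluded, as in algType. *)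
Definition is_algebra (A : lmodType k) (mul : A -> A -> A) (one : A) : Prop :=
  [/\ bilin mul, associative mul, left_id one mul, right_id one mul & one != 0].

Definition is_coalgebra (C : lmodType k) (D : C -> (C ⊗ C)%type) (e : C -> k)
    : Prop :=
  [/\ linear D, scalar e,
      forall c, \tsum_(x ⊗ y <- D c) \tsum_(a ⊗ b <- D x) (a ⊗ (b ⊗ y))
              = \tsum_(x ⊗ y <- D c) \tsum_(a ⊗ b <- D y) (x ⊗ (a ⊗ b)),
      forall c, \tsum_(x ⊗ y <- D c) (e x *: y) = c
    & forall c, \tsum_(x ⊗ y <- D c) (e y *: x) = c].

Definition is_right_comodule (C : lmodType k) (D : C -> (C ⊗ C)%type)
    (e : C -> k) (V : lmodType k) (rho : V -> (V ⊗ C)%type) : Prop :=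
  [/\ linear rho,
      forall v, \tsum_(x ⊗ c <- rho v) \tsum_(y ⊗ d <- rho x) (y ⊗ (d ⊗ c))
              = \tsum_(x ⊗ c <- rho v) \tsum_(d ⊗ d' <- D c) (x ⊗ (d ⊗ d'))
    & forall v, \tsum_(x ⊗ c <- rho v) (e c *: x) = v].

Definition is_left_comodule (C : lmodType k) (D : C -> (C ⊗ C)%type)
    (e : C -> k) (V : lmodType k) (rho : V -> (C ⊗ V)%type) : Prop :=
  [/\ linear rho,
      forall v, \tsum_(c ⊗ x <- rho v) \tsum_(d ⊗ d' <- D c) (d ⊗ (d' ⊗ x))
              = \tsum_(c ⊗ x <- rho v) \tsum_(d ⊗ y <- rho x) (c ⊗ (d ⊗ y))
    & forall v, \tsum_(c ⊗ x <- rho v) (e c *: x) = v].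

Definition is_conv_inverse (C : lmodType k) (D : C -> (C ⊗ C)%type)
    (e : C -> k) (A : lmodType k) (mul : A -> A -> A) (one : A)
    (f g : C -> A) : Prop :=
  forall c, \tsum_(x ⊗ y <- D c) mul (f x) (g y) = e c *: one
         /\ \tsum_(x ⊗ y <- D c) mul (g x) (f y) = e c *: one.

(* The same for linear forms, i.e. for the target algebra k. *)
Definition is_conv_inverse_form (C : lmodType k) (D : C -> (C ⊗ C)%type)
    (e f g : C -> k) : Prop :=
  forall c, \tsum_(x ⊗ y <- D c) (f x * g y) = e c
         /\ \tsum_(x ⊗ y <- D c) (g x * f y) = e c.

Record hopfAlg := HopfAlg {
  hopf_car :> algType k;
  comul : hopf_car -> (hopf_car ⊗ hopf_car)%type;
  counit : hopf_car -> k;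
  antipode : hopf_car -> hopf_car;
  hopf_coalgebra : is_coalgebra comul counit;
  comulM : forall x y, comul (x * y) =
    \tsum_(x1 ⊗ x2 <- comul x) \tsum_(y1 ⊗ y2 <- comul y)
      ((x1 * y1) ⊗ (x2 * y2));
  comul1 : comul 1 = 1 ⊗ 1;
  counitM : forall x y, counit (x * y) = counit x * counit y;
  counit1 : counit 1 = 1;
  antipode_linear : linear antipode;
  antipodeP : is_conv_inverse comul counit *%R 1 id antipode }.

End Structures.

Section YetterDrinfeld.
Variables (k : fieldType) (H : hopfAlg k).

Definition is_module (V : lmodType k) (act : H -> V -> V) : Prop :=
  [/\ bilin act, forall v, act 1 v = v
    & forall h g v, act (h * g) v = act h (act g v)].

Definition diag_act (V W : lmodType k) (aV : H -> V -> V) (aW : H -> W -> W)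
    (h : H) (t : (V ⊗ W)%type) : (V ⊗ W)%type :=
  \tsum_(h1 ⊗ h2 <- comul h) \tsum_(v ⊗ w <- t) (aV h1 v ⊗ aW h2 w).

Definition codiag_coact (V W : lmodType k) (dV : V -> (H ⊗ V)%type)
    (dW : W -> (H ⊗ W)%type) (t : (V ⊗ W)%type) : (H ⊗ (V ⊗ W))%type :=
  \tsum_(v ⊗ w <- t) \tsum_(g ⊗ v0 <- dV v) \tsum_(h ⊗ w0 <- dW w)
    ((g * h) ⊗ (v0 ⊗ w0)).

Definition is_YD (V : lmodType k) (act : H -> V -> V) (coact : V -> (H ⊗ V)%type)
    : Prop :=
  [/\ is_module act, is_left_comodule (@comul k H) (@counit k H) coact
    & forall h v, coact (act h v) =
        \tsum_(h1 ⊗ h' <- comul h) \tsum_(h2 ⊗ h3 <- comul h')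
        \tsum_(m ⊗ v0 <- coact v) ((h1 * m * antipode h3) ⊗ act h2 v0)].

(* Product (e ⊗ r)(e' ⊗ r') = e (r_(-1) . e') ⊗ r_(0) r' on E ⊗ R, for an
   algebra E with an H-action and an algebra R with an H-coaction. *)
Definition braided_mul (E R : lmodType k) (mulE : E -> E -> E)
    (actE : H -> E -> E) (mulR : R -> R -> R) (coR : R -> (H ⊗ R)%type)
    (x y : (E ⊗ R)%type) : (E ⊗ R)%type :=
  \tsum_(e ⊗ r <- x) \tsum_(e' ⊗ r' <- y) \tsum_(m ⊗ r0 <- coR r)
    (mulE e (actE m e') ⊗ mulR r0 r').

(* Hopf algebras in the braided category of left-left Yetter-Drinfeld modules:
   all the structure maps are H-linear and H-colinear. *)
Record ydHopfAlg := YDHopfAlg {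
  yd_car :> algType k;
  act : H -> yd_car -> yd_car;
  coact : yd_car -> (H ⊗ yd_car)%type;
  bcomul : yd_car -> (yd_car ⊗ yd_car)%type;
  bcounit : yd_car -> k;
  bantipode : yd_car -> yd_car;
  yd_YD : is_YD act coact;
  act_mul : forall h r s, act h (r * s) =
    \tsum_(h1 ⊗ h2 <- comul h) (act h1 r * act h2 s);
  act_one : forall h, act h 1 = counit h *: 1;
  coact_mul : forall r s, coact (r * s) =
    \tsum_(g ⊗ r0 <- coact r) \tsum_(h ⊗ s0 <- coact s)
      ((g * h) ⊗ (r0 * s0));
  coact_one : coact 1 = 1 ⊗ 1;
  yd_coalgebra : is_coalgebra bcomul bcounit;
  bcomul_act : forall h r, bcomul (act h r) = diag_act act act h (bcomul r);
  bcounit_act : forall h r, bcounit (act h r) = counit h * bcounit r;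
  bcomul_coact : forall r, codiag_coact coact coact (bcomul r) =
    \tsum_(m ⊗ r0 <- coact r) (m ⊗ bcomul r0);
  bcounit_coact : forall r,
    \tsum_(m ⊗ r0 <- coact r) (bcounit r0 *: m) = bcounit r *: 1;
  bcomulM : forall r s, bcomul (r * s) =
    braided_mul *%R act *%R coact (bcomul r) (bcomul s);
  bcomul1 : bcomul 1 = 1 ⊗ 1;
  bcounitM : forall r s, bcounit (r * s) = bcounit r * bcounit s;
  bcounit1 : bcounit 1 = 1;
  bantipode_linear : linear bantipode;
  bantipode_act : forall h r, bantipode (act h r) = act h (bantipode r);
  bantipode_coact : forall r, coact (bantipode r) =
    \tsum_(m ⊗ r0 <- coact r) (m ⊗ bantipode r0);
  bantipodeP : is_conv_inverse bcomul bcounit *%R 1 id bantipode }.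

End YetterDrinfeld.

Arguments act {k H} R h r : rename.
Arguments coact {k H} R r : rename.
Arguments bcomul {k H} R r : rename.
Arguments bcounit {k H} R r : rename.
Arguments bantipode {k H} R r : rename.

(* Isomorphism classes are subsets of the type of all representatives.  They are
   plain predicates: [set T] of mathcomp-classical lives in a universe too small
   for a type T of structures (hence also no [set_bij] below). *)
Definition iso_class (T : Type) (iso : T -> T -> Prop) (x : T) : T -> Prop :=
  fun y => iso x y.

Definition iso_classes (T : Type) (iso : T -> T -> Prop) (P : T -> Prop) :
    (T -> Prop) -> Prop :=
  fun C => exists2 x, P x & C = iso_class iso x.

Definition bij_between (S T : Type) (A : S -> Prop) (B : T -> Prop) (f : S -> T)
    : Prop :=
  [/\ forall x, A x -> B (f x),
      forall x y, A x -> A y -> f x = f y -> x = y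
    & forall y, B y -> exists2 x, A x & f x = y].

Section OverR.
Variables (k : fieldType) (H : hopfAlg k) (R : ydHopfAlg H).

Definition RR_comul (t : (R ⊗ R)%type) : ((R ⊗ R) ⊗ (R ⊗ R))%type :=
  \tsum_(r ⊗ s <- t) \tsum_(r1 ⊗ r2 <- bcomul R r) \tsum_(s1 ⊗ s2 <- bcomul R s)
  \tsum_(m ⊗ r20 <- coact R r2) ((r1 ⊗ act R m s1) ⊗ (r20 ⊗ s2)).

Definition RR_counit (t : (R ⊗ R)%type) : k :=
  \tsum_(r ⊗ s <- t) (bcounit R r * bcounit R s).

Definition RR_form_Hlinear (f : (R ⊗ R)%type -> k) : Prop :=
  forall h t, f (diag_act (act R) (act R) h t) = counit h * f t.

Definition ZR : ((R ⊗ R)%type -> k) -> Prop := fun pi =>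
  [/\ scalar pi, RR_form_Hlinear pi,
      exists tau : (R ⊗ R)%type -> k,
        [/\ scalar tau, RR_form_Hlinear tau
          & is_conv_inverse_form RR_comul RR_counit pi tau],
      pi (1 ⊗ 1) = 1
    & forall r s t : R,
        \tsum_(r1 ⊗ r2 <- bcomul R r) \tsum_(s1 ⊗ s2 <- bcomul R s)
        \tsum_(m ⊗ r20 <- coact R r2)
          (pi (r1 ⊗ act R m s1) * pi ((r20 * s2) ⊗ t))
      = \tsum_(s1 ⊗ s2 <- bcomul R s) \tsum_(t1 ⊗ t2 <- bcomul R t)
        \tsum_(m ⊗ s20 <- coact R s2)
          (pi (s1 ⊗ act R m t1) * pi (r ⊗ (s20 * t2)))].

(* The data of a pair (E, gamma), before any axiom is imposed. *)
Record cleftR := CleftR {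
  cR_car :> lmodType k;
  cR_mul : cR_car -> cR_car -> cR_car;
  cR_one : cR_car;
  cR_act : H -> cR_car -> cR_car;
  cR_coact : cR_car -> (cR_car ⊗ R)%type;
  cR_sec : R -> cR_car }.

Definition is_module_algebra (E : cleftR) : Prop :=
  [/\ is_algebra (@cR_mul E) (cR_one E), is_module (@cR_act E),
      forall h (e e' : E), cR_act h (cR_mul e e') =
        \tsum_(h1 ⊗ h2 <- comul h) cR_mul (cR_act h1 e) (cR_act h2 e')
    & forall h, cR_act h (cR_one E) = counit h *: cR_one E].

Definition is_comodule_algebra_R (E : cleftR) : Prop :=
  [/\ is_right_comodule (bcomul R) (bcounit R) (@cR_coact E),
      forall h (e : E),
        cR_coact (cR_act h e) = diag_act (@cR_act E) (act R) h (cR_coact e),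
      forall e e' : E, cR_coact (cR_mul e e') =
        braided_mul (@cR_mul E) (@cR_act E) *%R (coact R)
          (cR_coact e) (cR_coact e'),
      cR_coact (cR_one E) = cR_one E ⊗ 1
    & forall e : E, cR_coact e = e ⊗ 1 <-> exists c : k, e = c *: cR_one E].

Definition is_section_R (E : cleftR) : Prop :=
  [/\ linear (@cR_sec E),
      forall h r, @cR_sec E (act R h r) = cR_act h (cR_sec E r),
      forall r, cR_coact (cR_sec E r) =
        \tsum_(r1 ⊗ r2 <- bcomul R r) (cR_sec E r1 ⊗ r2),
      exists g : R -> E,
        [/\ linear g, forall h r, g (act R h r) = cR_act h (g r)
          & is_conv_inverse (bcomul R) (bcounit R)
              (@cR_mul E) (cR_one E) (@cR_sec E) g]
    & cR_sec E 1 = cR_one E].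

Definition is_cleftR (E : cleftR) : Prop :=
  [/\ is_module_algebra E, is_comodule_algebra_R E & is_section_R E].

Definition isoR (E E' : cleftR) : Prop :=
  exists f : E -> E',
    [/\ linear f /\ bijective f,
        (forall x y, f (cR_mul x y) = cR_mul (f x) (f y))
          /\ f (cR_one E) = cR_one E',
        forall h x, f (cR_act h x) = cR_act h (f x),
        forall x, cR_coact (f x) = \tsum_(e ⊗ r <- cR_coact x) (f e ⊗ r)
      & forall r, f (cR_sec E r) = cR_sec E' r].

Definition CR : (cleftR -> Prop) -> Prop := iso_classes isoR is_cleftR.

(* The pair (k #_pi R, id). *)
Definition twistR (pi : (R ⊗ R)%type -> k) : cleftR := @CleftR R
  (fun r s =>
     \tsum_(r1 ⊗ r2 <- bcomul R r) \tsum_(s1 ⊗ s2 <- bcomul R s)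
     \tsum_(m ⊗ r20 <- coact R r2) (pi (r1 ⊗ act R m s1) *: (r20 * s2)))
  1 (act R) (bcomul R) id.

Definition alphaR (pi : (R ⊗ R)%type -> k) : cleftR -> Prop :=
  iso_class isoR (twistR pi).

End OverR.

Section OverB.
Variable k : fieldType.

(* The structure maps of a bialgebra. *)
Record bialgData := BialgData {
  b_car :> lmodType k;
  b_mul : b_car -> b_car -> b_car;
  b_one : b_car;
  b_comul : b_car -> (b_car ⊗ b_car)%type;
  b_counit : b_car -> k }.

Variable B : bialgData.

Definition BB_comul (t : (B ⊗ B)%type) : ((B ⊗ B) ⊗ (B ⊗ B))%type :=
  \tsum_(x ⊗ y <- t) \tsum_(x1 ⊗ x2 <- b_comul x) \tsum_(y1 ⊗ y2 <- b_comul y)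
    ((x1 ⊗ y1) ⊗ (x2 ⊗ y2)).

Definition BB_counit (t : (B ⊗ B)%type) : k :=
  \tsum_(x ⊗ y <- t) (b_counit x * b_counit y).

Definition ZB : ((B ⊗ B)%type -> k) -> Prop := fun sigma =>
  [/\ scalar sigma,
      exists2 tau : (B ⊗ B)%type -> k, scalar tau
        & is_conv_inverse_form BB_comul BB_counit sigma tau,
      sigma (b_one B ⊗ b_one B) = 1
    & forall x y z : B,
        \tsum_(x1 ⊗ x2 <- b_comul x) \tsum_(y1 ⊗ y2 <- b_comul y)
          (sigma (x1 ⊗ y1) * sigma (b_mul x2 y2 ⊗ z))
      = \tsum_(y1 ⊗ y2 <- b_comul y) \tsum_(z1 ⊗ z2 <- b_comul z)
          (sigma (y1 ⊗ z1) * sigma (x ⊗ b_mul y2 z2))].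

(* The data of a pair (E, gamma), before any axiom is imposed. *)
Record cleftB := CleftB {
  cB_car :> lmodType k;
  cB_mul : cB_car -> cB_car -> cB_car;
  cB_one : cB_car;
  cB_coact : cB_car -> (cB_car ⊗ B)%type;
  cB_sec : B -> cB_car }.

Definition is_comodule_algebra_B (E : cleftB) : Prop :=
  [/\ is_algebra (@cB_mul E) (cB_one E),
      is_right_comodule (@b_comul B) (@b_counit B) (@cB_coact E),
      forall e e' : E, cB_coact (cB_mul e e') =
        \tsum_(x ⊗ b <- cB_coact e) \tsum_(x' ⊗ b' <- cB_coact e')
          (cB_mul x x' ⊗ b_mul b b'),
      cB_coact (cB_one E) = cB_one E ⊗ b_one B
    & forall e : E,
        cB_coact e = e ⊗ b_one B <-> exists c : k, e = c *: cB_one E].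

Definition is_section_B (E : cleftB) : Prop :=
  [/\ linear (@cB_sec E),
      forall b, cB_coact (cB_sec E b) =
        \tsum_(b1 ⊗ b2 <- b_comul b) (cB_sec E b1 ⊗ b2),
      exists2 g : B -> E, linear g
        & is_conv_inverse (@b_comul B) (@b_counit B)
            (@cB_mul E) (cB_one E) (@cB_sec E) g
    & cB_sec E (b_one B) = cB_one E].

Definition is_cleftB (E : cleftB) : Prop :=
  is_comodule_algebra_B E /\ is_section_B E.

Definition isoB (E E' : cleftB) : Prop :=
  exists f : E -> E',
    [/\ linear f /\ bijective f,
        (forall x y, f (cB_mul x y) = cB_mul (f x) (f y))
          /\ f (cB_one E) = cB_one E',
        forall x, cB_coact (f x) = \tsum_(e ⊗ b <- cB_coact x) (f e ⊗ b)
      & forall b, f (cB_sec E b) = cB_sec E' b].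

Definition CB : (cleftB -> Prop) -> Prop := iso_classes isoB is_cleftB.

(* The pair (k #_sigma B, id). *)
Definition twistB (sigma : (B ⊗ B)%type -> k) : cleftB := @CleftB B
  (fun x y =>
     \tsum_(x1 ⊗ x2 <- b_comul x) \tsum_(y1 ⊗ y2 <- b_comul y)
       (sigma (x1 ⊗ y1) *: b_mul x2 y2))
  (b_one B) (@b_comul B) id.

Definition alphaB (sigma : (B ⊗ B)%type -> k) : cleftB -> Prop :=
  iso_class isoB (twistB sigma).

End OverB.

Section Bosonization.
Variables (k : fieldType) (H : hopfAlg k) (R : ydHopfAlg H).

Definition smash_mul (A : lmodType k) (mul : A -> A -> A) (actA : H -> A -> A)
    (x y : (A ⊗ H)%type) : (A ⊗ H)%type :=
  \tsum_(a ⊗ h <- x) \tsum_(a' ⊗ h' <- y) \tsum_(h1 ⊗ h2 <- comul h)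
    (mul a (actA h1 a') ⊗ (h2 * h')).

(* e ⊗ h |-> (e_(0) ⊗ e_(1)(-1) h_(1)) ⊗ (e_(1)(0) ⊗ h_(2)); the comultiplication
   of R # H is the case A = R. *)
Definition smash_coact (A : lmodType k) (rho : A -> (A ⊗ R)%type)
    (x : (A ⊗ H)%type) : ((A ⊗ H) ⊗ (R ⊗ H))%type :=
  \tsum_(a ⊗ h <- x) \tsum_(a0 ⊗ r <- rho a) \tsum_(m ⊗ r0 <- coact R r)
  \tsum_(h1 ⊗ h2 <- comul h) ((a0 ⊗ (m * h1)) ⊗ (r0 ⊗ h2)).

Definition boson : bialgData k := @BialgData k (R ⊗ H)%type
  (smash_mul *%R (act R)) (1 ⊗ 1) (smash_coact (bcomul R))
  (fun x => \tsum_(r ⊗ h <- x) (bcounit R r * counit h)).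

Definition Z'boson : ((boson ⊗ boson)%type -> k) -> Prop := fun sigma =>
  ZB sigma /\
  forall (r r' : R) (h h' : H),
    sigma (((r ⊗ h) : boson) ⊗ ((r' ⊗ h') : boson)) =
    sigma (((r ⊗ 1) : boson) ⊗ ((act R h r' ⊗ 1) : boson)) * counit h'.

Definition is_H_balanced (E : cleftB boson) : Prop :=
  forall (r : R) (h h' h'' : H),
    cB_sec E (b_mul (b_mul ((1 ⊗ h) : boson) (r ⊗ h')) (1 ⊗ h'')) =
    cB_mul (cB_mul (cB_sec E (1 ⊗ h)) (cB_sec E (r ⊗ h'))) (cB_sec E (1 ⊗ h'')).

Definition C'boson : (cleftB boson -> Prop) -> Prop :=
  iso_classes (@isoB k boson) (fun E => is_cleftB E /\ is_H_balanced E).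

(* The pair (E # H, gamma ⊗ id). *)
Definition smash (E : cleftR R) : cleftB boson :=
  @CleftB k boson (E ⊗ H)%type
    (smash_mul (@cR_mul _ _ _ E) (@cR_act _ _ _ E)) (cR_one E ⊗ 1)
    (smash_coact (@cR_coact _ _ _ E))
    (fun x => \tsum_(r ⊗ h <- x) (cR_sec E r ⊗ h)).

End Bosonization.

(* Main.v *)
(* A cleft object (E, δ) over a bialgebra B is isomorphic to k #_σ B: writing δ̄
   for the convolution inverse of δ, the element e_(0) δ̄(e_(1)) is coinvariant,
   say ω(e) 1, so e = ω(e_(0)) δ(e_(1)); hence δ is bijective and
   σ(x, y) = ω(δ(x) δ(y)) is a 2-cocycle, with inverse
   ω(δ(x_(1) y_(1)) δ̄(y_(2)) δ̄(x_(2))).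

   If (E, γ) is R-cleft then E # H is cleft over R # H, the section γ ⊗ id having
   inverse r ⊗ h ↦ (1 ⊗ S(r_(-1) h)) (γ̄(r_(0)) ⊗ 1).  For E = k #_π R the
   2-cocycle of E # H is Φ(π), so Φ(π) is a cocycle and Ψ α_R = α Φ.  Conversely
   σ ∈ Z'(R # H) restricts to R ⊗ R: its convolution inverse has the same
   H-balancedness because convolution inverses are unique.  Ψ is injective because
   an isomorphism E # H ≅ E' # H over the sections has the form f ⊗ id, and
   surjective because an H-balanced section has its cocycle in Z'(R # H). *)

Require Import Defs.
From mathcomp Require Import all_boot all_order all_algebra.
From mathcomp Require Import boolp ring.

Set Implicit Arguments.
Unset Strict Implicit.
Unset Printing Implicit Defensive.

Import GRing.Theory.
Local Open Scope ring_scope.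

(** * Sweedler sums *)

(* A Sweedler sum is a nest of [tlift]s.  As [tlift F t] is a literal finite sum
   over [repr t], independent sums commute for arbitrary [F]; bilinearity of [F] is
   needed only to evaluate at a computed tensor, and the tactics below derive it
   from the syntax of [F], using the hints in [sweedler]. *)
Create HintDb sweedler.

(** The braided side is reduced to the ordinary bialgebra R # H wherever possible. The cocycle
    identity of Φ(π) comes from associativity in (k #_π R) # H, so the work there is to show that k
    #_π R is cleft; the delicate point is the convolution inverse of its identity map. In the same
    way a section γ over R is shown to be onto through γ ⊗ id. Conversely let π be the restriction
    of σ in Z'(R # H). The definition of Z' lets factors from H leave the second argument on the
    right and cross from the first argument to the second, whereas H-linearity of π amounts to
    invariance of σ under left multiplication of its first argument by H. That invariance is
    extracted from the cocycle identity at (h, x, y), using σ(h, z) = ε(h) ε(z) for h in H. It is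
    needed for the inverse of σ as well, since the inverse of π must be H-linear. For surjectivity
    of Ψ, no coinvariant subalgebra is cut out of a given cleft object: the preimage is k #_π R,
    with π the restriction of its cocycle. *)

Definition trilin (k : fieldType) (U V W X : lmodType k) (F : U -> V -> W -> X)
    : Prop :=
  [/\ forall v w, linear (fun u => F u v w), forall u w, linear (fun v => F u v w)
    & forall u v, linear (fun w => F u v w)].

Section Linear.
Variables (k : fieldType) (U V W : lmodType k).

Lemma eq_tlift (Y : nmodType) (F G : V -> W -> Y) (t : (V ⊗ W)%type) :
  (forall v w, F v w = G v w) -> tlift F t = tlift G t.
Proof. by move=> h; apply: eq_bigr => p _. Qed.

Lemma lin_id : linear (@id U). Proof. by []. Qed.

Lemma lin_comp (g : V -> W) (f : U -> V) :
  linear g -> linear f -> linear (fun x => g (f x)).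
Proof. by move=> lg lf a x y; rewrite lf lg. Qed.

Lemma lin_compk (g : V -> k^o) (f : U -> V) :
  linear g -> linear f -> linear ((fun x => g (f x)) : U -> k^o).
Proof. by move=> lg lf a x y; rewrite lf lg. Qed.

Lemma lin0 (g : V -> W) : linear g -> g 0 = 0.
Proof. by move=> lg; have := lg (-1) 0 0; rewrite scaler0 addr0 scaleN1r addNr. Qed.

Lemma linZ (g : V -> W) : linear g -> forall a v, g (a *: v) = a *: g v.
Proof. by move=> lg a v; have := lg a v 0; rewrite !addr0 (lin0 lg) addr0. Qed.

Lemma linD (g : V -> W) : linear g -> forall v w, g (v + w) = g v + g w.
Proof. by move=> lg v w; have := lg 1 v w; rewrite !scale1r. Qed.

End Linear.

Section TliftLinear.
Variables (k : fieldType) (U V W X : lmodType k).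
Implicit Types (t : (V ⊗ W)%type).

Lemma lin_tlift_body (F : U -> V -> W -> X) t :
  (forall v w, linear (fun x => F x v w)) ->
  linear (fun x => tlift (F x) t).
Proof.
move=> lF a x y; rewrite /tlift scaler_sumr -big_split.
by apply: eq_bigr => p _; rewrite lF.
Qed.

Lemma lin_tlift_arg (F : V -> W -> X) (f : U -> (V ⊗ W)%type) :
  bilin F -> linear f -> linear (fun x => tlift F (f x)).
Proof. by move=> bF lf; apply: lin_comp => //; apply: tlift_linear. Qed.

Lemma lin_scalel (f : U -> k^o) (v : V) : linear f -> linear (fun x => f x *: v).
Proof. by move=> lf a x y; rewrite lf scalerDl scalerA. Qed.

Lemma lin_scaler (a : k) (f : U -> V) : linear f -> linear (fun x => a *: f x).
Proof. by move=> lf b x y; rewrite lf scalerDr !scalerA mulrC. Qed.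

Lemma lin_kmull (f : U -> k^o) (c : k) :
  linear f -> linear ((fun x => f x * c) : U -> k^o).
Proof. by move=> lf a x y; rewrite lf mulrDl -mulrA. Qed.

Lemma lin_kmulr (f : U -> k^o) (c : k) :
  linear f -> linear ((fun x => c * f x) : U -> k^o).
Proof. by move=> lf a x y; rewrite lf mulrDr mulrCA. Qed.

Lemma bilinl (op : U -> V -> W) v : bilin op -> linear (fun x => op x v).
Proof. by case. Qed.

Lemma bilinr (op : U -> V -> W) u : bilin op -> linear (op u).
Proof. by case. Qed.

Lemma tlift_lin (g : X -> U) (F : V -> W -> X) t :
  linear g -> g (tlift F t) = tlift (fun v w => g (F v w)) t.
Proof.
move=> lg; rewrite /tlift; elim: (repr t) => [|p s IH].
  by rewrite !big_nil lin0.
by rewrite !big_cons linD // IH.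
Qed.

End TliftLinear.

(* Restatements at codomain [k^o]: [k] itself is not syntactically an [lmodType]. *)
Section TliftForm.
Variables (k : fieldType) (U V W X : lmodType k).

Lemma lin_tlift_bodyk (F : U -> V -> W -> k^o) (t : (V ⊗ W)%type) :
  (forall v w, linear (fun x => F x v w)) ->
  linear ((fun x => tlift (F x) t) : U -> k^o).
Proof. exact: lin_tlift_body. Qed.

Lemma lin_tlift_argk (F : V -> W -> k^o) (f : U -> (V ⊗ W)%type) :
  bilin F -> linear f -> linear ((fun x => tlift F (f x)) : U -> k^o).
Proof. exact: lin_tlift_arg. Qed.

Lemma lin_scalelk (f : U -> k^o) (v : k^o) :
  linear f -> linear ((fun x => f x *: v) : U -> k^o).
Proof. exact: lin_scalel. Qed.

Lemma lin_scalerk (a : k) (f : U -> k^o) :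
  linear f -> linear ((fun x => a *: f x) : U -> k^o).
Proof. exact: lin_scaler. Qed.

Lemma tlift_link (g : k^o -> X) (F : V -> W -> k^o) (t : (V ⊗ W)%type) :
  linear g -> g (tlift F t) = tlift (fun v w => g (F v w)) t.
Proof. exact: tlift_lin. Qed.

Lemma tlift_linto (g : X -> k^o) (F : V -> W -> X) (t : (V ⊗ W)%type) :
  linear g -> g (tlift F t) = tlift ((fun v w => g (F v w)) : V -> W -> k^o) t.
Proof. exact: tlift_lin. Qed.

Lemma linZto (g : V -> k^o) : linear g -> forall a v, g (a *: v) = a *: g v.
Proof. exact: linZ. Qed.

Lemma tliftZl (F : V -> W -> k) (u : U) (t : (V ⊗ W)%type) :
  tlift F t *: u = tlift (fun v w => F v w *: u) t.
Proof. by rewrite /tlift scaler_suml. Qed.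

End TliftForm.

Lemma lin_scale_id (k : fieldType) (a : k) : linear ((fun x => a *: x) : k^o -> k^o).
Proof. by move=> b x y; rewrite scalerDr !scalerA mulrC. Qed.

Lemma mul_bilin (k : fieldType) (A : algType k) : bilin (@GRing.mul A).
Proof.
split=> [w a u v|v a u w]; first by rewrite mulrDl scalerAl.
by rewrite mulrDr scalerAr.
Qed.

#[global] Hint Resolve tens_bilin : sweedler.
#[global] Hint Extern 0 (bilin (@GRing.mul _)) => apply mul_bilin : sweedler.

Ltac lin_base :=
  cbv beta;
  first [ solve [auto 2 with sweedler]
        | match goal with
          | h : forall _, GRing.linear_for _ _ |- _ => exact (h _)
          | h : forall _ _, GRing.linear_for _ _ |- _ => exact (h _ _)
          end
        | lazymatch goal with
          | |- GRing.linear_for _ (?op ?c) =>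
              apply (bilinr (op := op)); solve [auto 2 with sweedler]
          end ].

(** Relies on each Sweedler variable occurring once in a summand: at every node a single argument
    depends on the bound variable, and the cases find out which. *)
Ltac slin :=
  cbv beta;
  lazymatch goal with
  | |- GRing.linear_for _ (fun x => x) => apply lin_id
  | |- GRing.linear_for _ (fun x => @tlift _ _ _ _ (@?F x) (@?f x)) =>
      lazymatch f with
      | (fun _ => ?c) => first [ apply (lin_tlift_body (F := F))
                              | apply (lin_tlift_bodyk (F := F)) ]; intros ? ?; slin
      | _ =>
        lazymatch F with
        | (fun _ => ?F') => first [ apply (lin_tlift_arg (F := F') (f := f))
                                 | apply (lin_tlift_argk (F := F') (f := f)) ];
                           [sbilin | slin]
        end
      end
  | |- GRing.linear_for _ (fun x => @GRing.scale _ _ (@?f x) (@?v x)) =>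
      lazymatch v with
      | (fun _ => ?v') => first [ apply (@lin_scalel _ _ _ f v')
                               | apply (@lin_scalelk _ _ f v') ]; slin
      | _ => lazymatch f with
             | (fun _ => ?f') =>
               first [ first [ apply (@lin_scaler _ _ _ f' v)
                             | apply (@lin_scalerk _ _ f' v) ]; slin
                     | exact (@lin_scale_id _ f') ]
             end
      end
  | |- GRing.linear_for _ (fun x : ?T => ?g ?f) =>
      first [ solve [auto 2 with sweedler nocore]
      | slin_kmul
      | let G := constr:(fun x : T => g) in
      let F := constr:(fun x : T => f) in
      lazymatch G with
      | (fun _ => ?g') =>
        lazymatch F with
        | (fun x => x) => refine (_ : GRing.linear_for _ g'); lin_base
        | _ => first [ apply (lin_comp (g := g') (f := F))
                     | apply (lin_compk (g := g') (f := F)) ]; [lin_base | slin]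
        end
      | (fun x : ?T => ?op ?f1) =>
        let OP := constr:(fun x : T => op) in
        let F1 := constr:(fun x : T => f1) in
        lazymatch F with
        | (fun _ => ?c) =>
          lazymatch OP with
          | (fun _ => ?op') =>
            first [ apply (lin_comp (g := fun y => op' y c) (f := F1))
                  | apply (lin_compk (g := fun y => op' y c) (f := F1)) ];
            [first [ apply (@bilinl _ _ _ _ op' c); solve [auto 2 with sweedler]
                   | lin_base ] | slin]
          | (fun x : ?T => ?op2 ?f2) =>
            let OP2 := constr:(fun x : T => op2) in
            let F2 := constr:(fun x : T => f2) in
            lazymatch F1 with
            | (fun _ => ?c1) =>
              lazymatch OP2 with
              | (fun _ => ?op2') =>
                first [ apply (lin_comp (g := fun y => op2' y c1 c) (f := F2))
                      | apply (lin_compk (g := fun y => op2' y c1 c) (f := F2)) ];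
                [lin_base | slin]
              end
            end
          end
        end
      end ]
  | |- _ => lin_base
  end
with slin_kmul :=
  lazymatch goal with
  | |- GRing.linear_for _ (fun x => @GRing.mul _ (@?f x) (@?v x)) =>
      lazymatch v with
      | (fun _ => ?v') => apply (@lin_kmull _ _ f v'); slin
      | _ => lazymatch f with
             | (fun _ => ?f') => apply (@lin_kmulr _ _ v f'); slin
             end
      end
  end
with sbilin := split; intros ?; slin.
Ltac strilin := split; intros ? ?; slin.

Section TliftRewrite.
Variables (k : fieldType).

Lemma tlift_tlift (U V W X Y : lmodType k) (F : U -> V -> X)
    (G : W -> Y -> (U ⊗ V)%type) t : bilin F ->
  tlift F (tlift G t) = tlift (fun v w => tlift F (G v w)) t.
Proof. by move=> bF; apply: tlift_lin; apply: tlift_linear. Qed.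

Lemma tlift_id (V W : lmodType k) (t : (V ⊗ W)%type) : tlift tens t = t.
Proof. by rewrite {2}(tens_sum t). Qed.

Lemma tlift_scale (V W X : lmodType k) (a : k) (F : V -> W -> X) t :
  tlift (fun v w => a *: F v w) t = a *: tlift F t.
Proof. by rewrite /tlift scaler_sumr. Qed.

Lemma scale_swap (V : lmodType k) (a b : k) (v : V) : a *: (b *: v) = b *: (a *: v).
Proof. by rewrite !scalerA mulrC. Qed.

Lemma tlift_exch (U V W X : lmodType k) (Y : nmodType) (F : U -> V -> W -> X -> Y) s t :
  tlift (fun u v => tlift (fun w x => F u v w x) s) t =
  tlift (fun w x => tlift (fun u v => F u v w x) t) s.
Proof. exact: exchange_big. Qed.

(** The hypothesis lives in a triple tensor product; lifting [F] to that product and applying it to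
    both sides gives a rule for sums. With [f] and [g] independent, one statement serves coalgebras
    and left and right comodules. *)
Lemma assocP (A B C V W X : lmodType k) (f : V -> (A ⊗ B)%type)
   (g : W -> (B ⊗ C)%type) (s : (V ⊗ C)%type) (s' : (A ⊗ W)%type) :
  \tsum_(x ⊗ c <- s) \tsum_(y ⊗ d <- f x) (y ⊗ (d ⊗ c)) =
  \tsum_(x ⊗ c <- s') \tsum_(d ⊗ d' <- g c) (x ⊗ (d ⊗ d')) ->
  forall F : A -> B -> C -> X, trilin F ->
  \tsum_(x ⊗ c <- s) \tsum_(y ⊗ d <- f x) F y d c =
  \tsum_(x ⊗ c <- s') \tsum_(d ⊗ d' <- g c) F x d d'.
Proof.
move=> h F [F1 F2 F3].
pose L (a : A) (bc : (B ⊗ C)%type) := tlift (fun b c => F a b c) bc.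
have Lb : bilin L by rewrite /L; sbilin.
move: (congr1 (tlift L) h); rewrite !tlift_tlift // => hh.
transitivity (\tsum_(x ⊗ c <- s) tlift L (\tsum_(y ⊗ d <- f x) (y ⊗ (d ⊗ c)))).
  apply: eq_tlift => x c; rewrite tlift_tlift //; apply: eq_tlift => y d.
  by rewrite tliftE // /L tliftE //; sbilin.
rewrite hh; apply: eq_tlift => x c; rewrite tlift_tlift //.
apply: eq_tlift => y d; by rewrite tliftE // /L tliftE //; sbilin.
Qed.

End TliftRewrite.

(* The hooks [sw_dom], [sw_assoc] and [sw_counit] are the simplification,
   coassociativity and counit rules in force; below they are extended by the rules
   for H and R, and locally by those of the objects at hand. *)
Ltac sw_dom T := fail.
Ltac sw_assoc := fail.
Ltac sw_counit := fail.

(* The tactics prove goals [e = ?r] and instantiate [?r] with the rewritten [e]. *)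

(* pulls a [tlift] that is not under a binder out of its linear context *)
Ltac sw_pull :=
  lazymatch goal with
  | |- ?T = _ =>
    match T with
    | context [@GRing.scale ?K ?X (?a * ?b) ?u] =>
      let T' := eval pattern (@GRing.scale K X (a * b) u) in T in
      lazymatch T' with
      | ?g _ => refine (f_equal g (esym (scalerA a b u)))
      end
    | context [@GRing.scale ?K ?X (@tlift ?k ?V ?W ?U ?F ?t) ?u] =>
      let T' := eval pattern (@GRing.scale K X (@tlift k V W U F t) u) in T in
      lazymatch T' with
      | ?g _ => refine (f_equal g (tliftZl F u t))
      end
    | context [@tlift ?k ?V ?W ?U ?F ?t] =>
      let T' := eval pattern (@tlift k V W U F t) in T in
      lazymatch T' with
      | ?g _ => first [ refine (@tlift_lin k _ _ _ _ g F t _)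
                      | refine (@tlift_link k _ _ _ g F t _)
                      | refine (@tlift_linto k _ _ _ g F t _) ]; slin
      end
    end
  end.

(* normal form with the sums outermost and the scalars in front of the summand *)
Ltac sw_push :=
  cbv beta;
  lazymatch goal with
  | |- @tlift ?K ?V ?W ?U ?F ?T = _ =>
    lazymatch T with
    | @tens _ _ _ _ _ =>
        refine (eq_trans (tliftE _ _ _) _); [sbilin | sw_push]
    | @tlift _ _ _ _ _ _ =>
        refine (eq_trans (tlift_tlift _ _ _) _); [sbilin | sw_push]
    | context [@tlift _ _ _ _ _ _] =>
        refine (eq_trans (f_equal (@tlift K V W U F) _) _); [sw_pull | sw_push]
    | ?a *: _ =>
        refine (eq_trans (linZ (tlift_linear _) a _) _); [sbilin | ];
        refine (eq_trans (f_equal (fun z => a *: z) _) _); [sw_push | sw_top]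
    | context [@GRing.scale _ _ _ _] =>
        refine (eq_trans (f_equal (@tlift K V W U F) _) _); [sw_front | sw_push]
    | _ =>
      first [ refine (eq_trans (f_equal (@tlift K V W U F) _) _);
              [sw_dom T; reflexivity | sw_push]
            | refine (@eq_tlift _ _ _ _ _ _ _ _); intros ? ?; sw_push ]
    end
  | |- ?X = _ =>
    lazymatch X with
    | context [@tlift _ _ _ _ _ _] =>
        refine (eq_trans _ _); [sw_pull | sw_push]
    | _ => first [refine (eq_trans _ _); [sw_dom X; reflexivity|]; sw_push | sw_front]
    end
  end
with sw_front :=
  lazymatch goal with
  | |- @GRing.scale ?K ?V ?c ?w = _ =>
    lazymatch c with
    | context [@GRing.scale ?K1 ?V1 ?a ?v] =>
      let c' := eval pattern (@GRing.scale K1 V1 a v) in c in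
      lazymatch c' with
      | ?g _ => refine (eq_trans (@linZ _ _ _ (fun z => @GRing.scale K V (g z) w) _ a v) _);
                [slin | cbv beta; sw_front]
      end
    | _ => sw_front2
    end
  | |- _ => sw_front2
  end
with sw_front2 :=
  lazymatch goal with
  | |- @GRing.scale ?K ?V ?a ?v = _ =>
      refine (eq_trans (f_equal (@GRing.scale K V a) _) _); [sw_front | sw_top]
  | |- ?X = _ =>
    match X with
    | context [@GRing.scale ?K ?V ?a ?v] =>
      let X' := eval pattern (@GRing.scale K V a v) in X in
      lazymatch X' with
      | ?g _ => first [ refine (eq_trans (@linZ _ _ _ g _ a v) _)
                      | refine (eq_trans (@linZto _ _ g _ a v) _) ];
                [slin | cbv beta; sw_front]
      end
    | _ => first [ refine (eq_trans _ _); [sw_dom X; reflexivity|]; sw_push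
                 | reflexivity ]
    end
  end
with sw_top :=
  lazymatch goal with
  | |- @GRing.scale ?K ?V ?a (@tlift ?k ?V1 ?W1 _ ?F ?t) = _ =>
      refine (eq_trans (esym (@tlift_scale _ _ _ _ a F t)) _);
      refine (@eq_tlift _ _ _ _ _ _ _ _); intros ? ?; sw_top
  | |- _ => reflexivity
  end.

(* moves the sum over [T] to the front *)
Ltac sw_float T :=
  cbv beta;
  lazymatch goal with
  | |- tlift _ T = _ => reflexivity
  | |- tlift _ ?T' = _ =>
     refine (eq_trans _ _);
     [ refine (@eq_tlift _ _ _ _ _ _ _ _); intros ? ?; sw_float T
     | refine (@tlift_exch _ _ _ _ _ _ _ _ _) ]
  end.

(* cancels equal sums on both sides, up to reordering *)
Ltac sw_strip :=
  repeat (cbv beta; lazymatch goal with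
  | |- tlift ?F ?T = tlift ?G ?T => refine (@eq_tlift _ _ _ _ _ _ _ _); intros ? ?
  | |- tlift ?F ?T = tlift ?G ?T' =>
     refine (eq_trans _ _); [ | symmetry; sw_float T ]
  end).

(* reassociates iterated coproducts to the right *)
Ltac sw_comb :=
  cbv beta;
  lazymatch goal with
  | |- @tlift ?k ?V ?W ?U ?F ?T = _ =>
    first
    [ refine (eq_trans (@eq_tlift k V W U F _ T _) _);
      [ let x := fresh "x" in let y := fresh "y" in intros x y; cbv beta;
        lazymatch goal with
        | |- ?E = _ =>
          lazymatch E with context [@tlift _ _ _ _ _ (?g x)] => sw_float (g x) end
        end
      | refine (eq_trans _ _); [ sw_assoc; strilin | sw_comb ] ]
    | refine (@eq_tlift _ _ _ _ _ _ _ _); intros ? ?; sw_comb ]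
  | |- _ => reflexivity
  end.

(* the prefixes l and r apply a tactic to the left- or right-hand side of the goal *)
Ltac lcomb := refine (eq_trans _ _); [sw_comb|cbv beta].
Ltac rcomb := symmetry; lcomb; symmetry.
Ltac lpush := refine (eq_trans _ _); [sw_push|cbv beta].
Ltac rpush := symmetry; lpush; symmetry.
Ltac sw := lpush; rpush; lcomb; rcomb; sw_strip; cbv beta.

(* proves [b = a *: ?F] *)
Ltac sw_scale a :=
  cbv beta;
  lazymatch goal with
  | |- a *: _ = _ => reflexivity
  | |- ?b *: _ = _ =>
      refine (eq_trans (f_equal (fun z => b *: z) _) _);
      [sw_scale a | refine (scale_swap b a _)]
  | |- tlift _ ?t = _ =>
      refine (eq_trans (@eq_tlift _ _ _ _ _ _ t _) _);
      [intros ? ?; sw_scale a | refine (@tlift_scale _ _ _ _ a _ t)]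
  end.

(* cancels counits against coproducts and coactions *)
Ltac sw_cu :=
  cbv beta;
  lazymatch goal with
  | |- @tlift ?k ?V ?W ?U ?F ?T = _ =>
    first
    [ refine (eq_trans (@eq_tlift k V W U F _ T _) _);
      [ let x := fresh "x" in let y := fresh "y" in intros x y; cbv beta;
        match goal with
        | |- ?E = _ =>
          match E with
          | context [@GRing.scale _ _ (?e x) _] =>
              refine (eq_trans _ _); [sw_scale (e x)|reflexivity]
          | context [@GRing.scale _ _ (?e y) _] =>
              refine (eq_trans _ _); [sw_scale (e y)|reflexivity]
          end
        end
      | refine (eq_trans _ _); [ sw_counit; slin | sw_cu ] ]
    | refine (@eq_tlift _ _ _ _ _ _ _ _); intros ? ?; sw_cu ]
  | |- ?a *: _ = _ => refine (f_equal (fun z => a *: z) _); sw_cu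
  | |- _ => reflexivity
  end.
Ltac lcu := refine (eq_trans _ _); [sw_cu|cbv beta].
Ltac rcu := symmetry; lcu; symmetry.

(* descends under the sums until [tac] applies *)
Ltac sw_at tac :=
  cbv beta;
  first [ solve [tac]
        | refine (@eq_tlift _ _ _ _ _ _ _ _); intros ? ?; sw_at tac
        | refine (f_equal (fun z => _ *: z) _); sw_at tac ].
Ltac lat tac := refine (eq_trans _ _); [sw_at tac|cbv beta].

(** * Calculation rules for Hopf algebras and Yetter-Drinfeld modules *)

Section Coalg.
Variables (k : fieldType) (C : lmodType k) (D : C -> (C ⊗ C)%type) (e : C -> k).
Hypothesis hC : is_coalgebra D e.

Lemma coalg_lin : linear D. Proof. by case: hC. Qed.

Lemma coalg_linc : linear (e : C -> k^o). Proof. by case: hC. Qed.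

Lemma coassoc (X : lmodType k) (F : C -> C -> C -> X) c : trilin F ->
  \tsum_(x ⊗ y <- D c) \tsum_(a ⊗ b <- D x) F a b y =
  \tsum_(x ⊗ y <- D c) \tsum_(a ⊗ b <- D y) F x a b.
Proof. by case: hC => _ _ h _ _; apply: assocP. Qed.

Lemma counitl (X : lmodType k) (F : C -> X) c : linear F ->
  \tsum_(x ⊗ y <- D c) (e x *: F y) = F c.
Proof.
case: hC => _ _ _ h _ lF; rewrite -{2}(h c) (tlift_lin _ _ lF).
by apply: eq_tlift => x y; rewrite linZ.
Qed.

Lemma counitr (X : lmodType k) (F : C -> X) c : linear F ->
  \tsum_(x ⊗ y <- D c) (e y *: F x) = F c.
Proof.
case: hC => _ _ _ _ h lF; rewrite -{2}(h c) (tlift_lin _ _ lF).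
by apply: eq_tlift => x y; rewrite linZ.
Qed.

Lemma conv_invr (A X : lmodType k) (mul : A -> A -> A) (one : A) (f g : C -> A)
    (F : A -> X) c :
  is_conv_inverse D e mul one f g -> linear F ->
  \tsum_(x ⊗ y <- D c) F (mul (f x) (g y)) = e c *: F one.
Proof. by move=> h lF; rewrite -(tlift_lin _ _ lF) (h c).1 (linZ lF). Qed.

Lemma conv_invl (A X : lmodType k) (mul : A -> A -> A) (one : A) (f g : C -> A)
    (F : A -> X) c :
  is_conv_inverse D e mul one f g -> linear F ->
  \tsum_(x ⊗ y <- D c) F (mul (g x) (f y)) = e c *: F one.
Proof. by move=> h lF; rewrite -(tlift_lin _ _ lF) (h c).2 (linZ lF). Qed.

End Coalg.

Section Hopf.
Variables (k : fieldType) (H : hopfAlg k).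

Lemma comul_lin : linear (@comul k H).
Proof. exact: coalg_lin (hopf_coalgebra H). Qed.

Lemma counit_lin : linear (@counit k H : H -> k^o).
Proof. exact: coalg_linc (hopf_coalgebra H). Qed.

Lemma antipode_lin : linear (@antipode k H).
Proof. exact: antipode_linear. Qed.

Definition Hcoassoc := @coassoc k _ _ _ (hopf_coalgebra H).
Definition Hcounitl := @counitl k _ _ _ (hopf_coalgebra H).
Definition Hcounitr := @counitr k _ _ _ (hopf_coalgebra H).

Lemma Hantil (X : lmodType k) (F : H -> X) c : linear F ->
  \tsum_(x ⊗ y <- comul c) F (antipode x * y) = counit c *: F 1.
Proof. exact: conv_invl (@antipodeP k H). Qed.

Lemma Hantir (X : lmodType k) (F : H -> X) c : linear F ->
  \tsum_(x ⊗ y <- comul c) F (x * antipode y) = counit c *: F 1.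
Proof. exact: conv_invr (@antipodeP k H). Qed.

End Hopf.

#[global] Hint Extern 0 (GRing.linear_for _ (@comul _ _)) =>
  exact: comul_lin : sweedler.
#[global] Hint Extern 0 (GRing.linear_for _ (@counit _ _)) =>
  exact: counit_lin : sweedler.
#[global] Hint Extern 0 (GRing.linear_for _ (@antipode _ _)) =>
  exact: antipode_lin : sweedler.

(* abstracts an antipode product to exhibit the redex of [Hantil] or [Hantir] *)
Ltac sw_abs x y :=
  cbv beta;
  lazymatch goal with
  | |- ?B = ?G _ =>
    match B with
    | context [@GRing.mul ?A (antipode x) y] =>
      let B' := eval pattern (@GRing.mul A (antipode x) y) in B in
      lazymatch B' with ?g _ => unify G g; reflexivity end
    | context [@GRing.mul ?A x (antipode y)] =>
      let B' := eval pattern (@GRing.mul A x (antipode y)) in B in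
      lazymatch B' with ?g _ => unify G g; reflexivity end
    end
  end.

Ltac sw_anti_at :=
  cbv beta;
  lazymatch goal with
  | |- @tlift ?k ?V ?W ?U ?F (@comul _ ?H ?c) = _ =>
    let G := open_constr:(_ : @hopf_car k H -> U) in
    first
    [ refine (@eq_trans _ _
              (@tlift k V W U (fun x y => G (antipode x * y)) (comul c)) _ _ _);
      [ refine (@eq_tlift _ _ _ _ _ _ _ _);
        let x := fresh in let y := fresh in intros x y; sw_abs x y
      | refine (Hantil _ _); slin ]
    | refine (@eq_trans _ _
              (@tlift k V W U (fun x y => G (x * antipode y)) (comul c)) _ _ _);
      [ refine (@eq_tlift _ _ _ _ _ _ _ _);
        let x := fresh in let y := fresh in intros x y; sw_abs x y
      | refine (Hantir _ _); slin ] ]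
  end.
Ltac lanti := lat sw_anti_at.

Section YD.
Variables (k : fieldType) (H : hopfAlg k) (R : ydHopfAlg H).

Lemma act_bilin : bilin (act R).
Proof. by case: (yd_YD R) => -[]. Qed.

Lemma act1 v : act R 1 v = v.
Proof. by case: (yd_YD R) => -[]. Qed.

Lemma actM h g v : act R (h * g) v = act R h (act R g v).
Proof. by case: (yd_YD R) => -[]. Qed.

Lemma coact_lin : linear (coact R).
Proof. by case: (yd_YD R) => _ []. Qed.

Lemma coactA (X : lmodType k) (F : H -> H -> R -> X) v : trilin F ->
  \tsum_(c ⊗ x <- coact R v) \tsum_(d ⊗ d' <- comul c) F d d' x =
  \tsum_(c ⊗ x <- coact R v) \tsum_(d ⊗ y <- coact R x) F c d y.
Proof. by apply: assocP; case: (yd_YD R) => _ []. Qed.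

Lemma coact_counit (X : lmodType k) (F : R -> X) v : linear F ->
  \tsum_(c ⊗ x <- coact R v) (counit c *: F x) = F v.
Proof.
case: (yd_YD R) => _ [_ _ h] _ lF; rewrite -{2}(h v) (tlift_lin _ _ lF).
by apply: eq_tlift => x y; rewrite linZ.
Qed.

Lemma bcomul_lin : linear (bcomul R).
Proof. exact: coalg_lin (yd_coalgebra R). Qed.

Lemma bcounit_lin : linear (bcounit R : R -> k^o).
Proof. exact: coalg_linc (yd_coalgebra R). Qed.

Definition bcoassoc := @coassoc k _ _ _ (yd_coalgebra R).
Definition bcounitl := @counitl k _ _ _ (yd_coalgebra R).
Definition bcounitr := @counitr k _ _ _ (yd_coalgebra R).

End YD.

#[global] Hint Extern 0 (bilin (@act _ _ _)) => apply act_bilin : sweedler.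
#[global] Hint Extern 0 (GRing.linear_for _ (@coact _ _ _)) =>
  exact: coact_lin : sweedler.
#[global] Hint Extern 0 (GRing.linear_for _ (@bcomul _ _ _)) =>
  exact: bcomul_lin : sweedler.
#[global] Hint Extern 0 (GRing.linear_for _ (@bcounit _ _ _)) =>
  exact: bcounit_lin : sweedler.
#[global] Hint Extern 0 (GRing.linear_for _ (@bantipode _ _ _)) =>
  exact: bantipode_linear : sweedler.

Ltac sw_local T := fail.
Ltac sw_assoc_local := fail.
Ltac sw_counit_local := fail.
Ltac sw_assoc ::=
  first [ refine (Hcoassoc _ _) | refine (bcoassoc _ _) | refine (coactA _ _)
        | sw_assoc_local ].
Ltac sw_counit ::=
  first [ refine (Hcounitl _ _) | refine (Hcounitr _ _)
        | refine (bcounitl _ _) | refine (bcounitr _ _)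
        | refine (coact_counit _ _) | sw_counit_local ].
Ltac sw_dom T ::=
  first
  [ lazymatch T with context [comul (_ * _)] => rewrite comulM end
  | lazymatch T with context [comul 1] => rewrite comul1 end
  | lazymatch T with context [coact _ (_ * _)] => rewrite coact_mul end
  | lazymatch T with context [coact _ 1] => rewrite coact_one end
  | lazymatch T with context [bcomul _ (_ * _)] => rewrite bcomulM /braided_mul end
  | lazymatch T with context [bcomul _ 1] => rewrite bcomul1 end
  | lazymatch T with context [bcomul _ (act _ _ _)] => rewrite bcomul_act /diag_act end
  | lazymatch T with context [act _ _ (_ * _)] => rewrite act_mul end
  | lazymatch T with context [act _ _ 1] => rewrite act_one end
  | lazymatch T with context [act _ 1 _] => rewrite act1 end
  | lazymatch T with context [act _ (_ * _) _] => rewrite actM end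
  | lazymatch T with context [counit (_ * _)] => rewrite counitM end
  | lazymatch T with context [counit 1] => rewrite counit1 end
  | lazymatch T with context [bcounit _ (_ * _)] => rewrite bcounitM end
  | lazymatch T with context [bcounit _ 1] => rewrite bcounit1 end
  | lazymatch T with context [bcounit _ (act _ _ _)] => rewrite bcounit_act end
  | lazymatch T with context [(_ * _) *: _] => rewrite -scalerA end
  | lazymatch T with context [_ * (_ * _)] => rewrite mulrA end
  | lazymatch T with context [_ * 1] => rewrite mulr1 end
  | lazymatch T with context [1 * _] => rewrite mul1r end
  | lazymatch T with context [1 *: _] => rewrite scale1r end
  | sw_local T].

Section YDCoalgebra.
Variables (k : fieldType) (H : hopfAlg k) (R : ydHopfAlg H).

Lemma coact_bcomul (X : lmodType k) (F : H -> R -> R -> X) r : trilin F ->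
  \tsum_(m ⊗ r0 <- coact R r) \tsum_(a ⊗ b <- bcomul R r0) F m a b =
  \tsum_(a ⊗ b <- bcomul R r) \tsum_(g ⊗ a0 <- coact R a)
    \tsum_(h ⊗ b0 <- coact R b) F (g * h) a0 b0.
Proof.
move=> [F1 F2 F3]; have h := bcomul_coact r.
have h2 : bilin (fun m t => \tsum_(a ⊗ b <- t) F m a b) by sbilin.
move: (congr1 (tlift (fun m t => \tsum_(a ⊗ b <- t) F m a b)) h).
rewrite /codiag_coact => {}h; symmetry.
refine (eq_trans _ (eq_trans h _)).
  symmetry; lpush; reflexivity.
lpush; reflexivity.
Qed.

Lemma coact_bcounit (X : lmodType k) (F : H -> X) r : linear F ->
  \tsum_(m ⊗ r0 <- coact R r) (bcounit R r0 *: F m) = bcounit R r *: F 1.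
Proof.
move=> lF; rewrite -(linZ lF) -bcounit_coact (tlift_lin _ _ lF).
by apply: eq_tlift => x y; rewrite linZ.
Qed.

Lemma bantil (X : lmodType k) (F : R -> X) c : linear F ->
  \tsum_(x ⊗ y <- bcomul R c) F (bantipode R x * y) = bcounit R c *: F 1.
Proof. exact: conv_invl (@bantipodeP k H R). Qed.

Lemma bantir (X : lmodType k) (F : R -> X) c : linear F ->
  \tsum_(x ⊗ y <- bcomul R c) F (x * bantipode R y) = bcounit R c *: F 1.
Proof. exact: conv_invr (@bantipodeP k H R). Qed.

End YDCoalgebra.

Ltac sw_counit ::=
  first [ refine (Hcounitl _ _) | refine (Hcounitr _ _)
        | refine (bcounitl _ _) | refine (bcounitr _ _)
        | refine (coact_counit _ _) | refine (coact_bcounit _ _)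
        | sw_counit_local ].

Section YDSwap.
Variables (k : fieldType) (H : hopfAlg k) (R : ydHopfAlg H).

(* The Yetter–Drinfeld condition without the antipode. *)
Lemma yd_swap (X : lmodType k) (F : H -> R -> X) (h : H) (v : R) : bilin F ->
  \tsum_(h1 ⊗ h2 <- comul h) \tsum_(m ⊗ w <- coact R (act R h1 v)) F (m * h2) w =
  \tsum_(h1 ⊗ h2 <- comul h) \tsum_(m ⊗ w <- coact R v) F (h1 * m) (act R h2 w).
Proof.
move=> bF; case: (yd_YD R) => _ _ yd.
transitivity (\tsum_(h1 ⊗ h2 <- comul h) tlift (fun m w => F (m * h2) w) (
   \tsum_(a ⊗ h' <- comul h1) \tsum_(b ⊗ c <- comul h')
        \tsum_(m ⊗ v0 <- coact R v) ((a * m * antipode c) ⊗ act R b v0))).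
  by apply: eq_tlift => h1 h2; rewrite yd.
(* The Yetter-Drinfeld condition contributes S(h_(3)), which now stands next to the extra factor
   h_(4) and cancels with it. *)
by lpush; lcomb; lat ltac:(rewrite -mulrA; reflexivity); lanti; lcu; lpush.
Qed.

(** The extra leg [h3] is the shape that the rule takes inside right-nested iterated coproducts,
    where the rest of h is still in use. *)
Lemma yd_swap3 (X : lmodType k) (F : H -> R -> H -> X) (h : H) (v : R) : trilin F ->
  \tsum_(h1 ⊗ h' <- comul h) \tsum_(h2 ⊗ h3 <- comul h')
    \tsum_(m ⊗ w <- coact R (act R h1 v)) F (m * h2) w h3 =
  \tsum_(h1 ⊗ h' <- comul h) \tsum_(h2 ⊗ h3 <- comul h')
    \tsum_(m ⊗ w <- coact R v) F (h1 * m) (act R h2 w) h3.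
Proof.
move=> [F1 F2 F3].
rewrite -(Hcoassoc (F := fun a b y => \tsum_(m ⊗ w <- coact R (act R a v))
  F (m * b) w y)); last by strilin.
rewrite -(Hcoassoc (F := fun a b y => \tsum_(m ⊗ w <- coact R v)
  F (a * m) (act R b w) y)); last by strilin.
by apply: eq_tlift => z h3; apply: (yd_swap (F := fun m w => F m w h3)); sbilin.
Qed.

End YDSwap.

(* moves the sums over [comul _] inwards past the other sums that do not depend on
   them *)
Ltac sw_sink :=
  cbv beta;
  lazymatch goal with
  | |- tlift _ _ = _ =>
    refine (eq_trans (@eq_tlift _ _ _ _ _ _ _ _) _);
    [ intros ? ?; sw_sink | sw_sink1 ]
  | |- _ => reflexivity
  end
with sw_sink1 :=
  cbv beta;
  lazymatch goal with
  | |- tlift (fun x y => @tlift _ _ _ _ (@?F x y) (@?T x y)) (comul _) = _ =>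
      lazymatch T with
      | (fun _ _ => comul _) => reflexivity
      | (fun _ _ => ?T') =>
        refine (eq_trans (@tlift_exch _ _ _ _ _ _ _ _ _) _);
        refine (@eq_tlift _ _ _ _ _ _ _ _); intros ? ?; sw_sink1
      | _ => reflexivity
      end
  | |- _ => reflexivity
  end.
Ltac lsink := refine (eq_trans _ _); [sw_sink|cbv beta].

Ltac sw_yd_at :=
  cbv beta;
  lazymatch goal with
  | |- @tlift ?k ?V ?W ?U ?F (@comul _ ?H ?c) = _ =>
    lazymatch F with
    | context [@coact _ _ ?R (@act _ _ _ _ ?v)] =>
      let G := open_constr:(_ : @hopf_car k H -> @yd_car k H R -> @hopf_car k H -> U) in
      refine (@eq_trans _ _ (@tlift k V W U (fun x y => tlift (fun c d =>
        tlift (fun m w => G (m * c) w d) (coact R (act R x v))) (comul y)) (comul c))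
        _ _ _);
      [ refine (@eq_tlift _ _ _ _ _ _ _ _);
        let x := fresh in let y := fresh in intros x y;
        refine (eq_trans _ _); [sw_float (@comul _ H y)|];
        refine (@eq_tlift _ _ _ _ _ _ _ _); intros ? ?;
        refine (eq_trans _ _); [sw_float (@coact k H R (act R x v))|];
        refine (@eq_tlift _ _ _ _ _ _ _ _); intros ? ?; sw_abs3
      | refine (yd_swap3 _ _ _); strilin ]
    end
  end
with sw_abs3 :=
  cbv beta;
  lazymatch goal with
  | |- ?B = ?G (@GRing.mul _ ?m ?c) ?w ?d =>
    try rewrite -(mulrA _ m c);
    lazymatch goal with
    | |- ?B = _ =>
      match B with
      | context [@GRing.mul ?A m c] =>
        let B' := eval pattern (@GRing.mul A m c), w, d in B in
        lazymatch B' with ?g _ _ _ => unify G g; reflexivity end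
      end
    end
  end.
Ltac lyd := lat sw_yd_at.

(* brings the sum over [coact r] next to the one over [bcomul r0] to apply
   [coact_bcomul] *)
Ltac sw_cb_at :=
  cbv beta;
  lazymatch goal with
  | |- @tlift ?k ?V ?W ?U ?F (@coact _ _ ?R ?r) = _ =>
    refine (eq_trans (@eq_tlift k V W U F _ _ _) _);
    [ let x := fresh "x" in let y := fresh "y" in intros x y; cbv beta;
      sw_float (@bcomul _ _ R y)
    | refine (coact_bcomul _ _); strilin ]
  end.
Ltac lcb := lat sw_cb_at.

Section CoactAntipode.
Variables (k : fieldType) (H : hopfAlg k) (R : ydHopfAlg H) (X : lmodType k).

(** By coassociativity of the coaction, with c = r_(-1), the first argument of [F] is (c h)_(1) S((c
    h)_(2)). This is the H-part of the right inverse of γ ⊗ id. *)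
Lemma coact_antipode (F : H -> R -> X) (r : R) (h : H) : bilin F ->
  \tsum_(m ⊗ w <- coact R r) \tsum_(m' ⊗ w' <- coact R w)
    \tsum_(h1 ⊗ h2 <- comul h) F (m * h1 * antipode (m' * h2)) w' =
  counit h *: F 1 r.
Proof.
move=> bF; rewrite -(coactA (F := fun m m' w' => \tsum_(h1 ⊗ h2 <- comul h)
  F (m * h1 * antipode (m' * h2)) w')); last by strilin.
transitivity (\tsum_(c ⊗ x <- coact R r)
    \tsum_(a ⊗ b <- comul (c * h)) F (a * antipode b) x).
  by apply: eq_tlift => c x; symmetry; lpush.
refine (eq_trans (@eq_tlift _ _ _ _ _ _ _ _) _).
  move=> c x; refine (@Hantir _ _ _ (fun z => F z x) _ _); slin.
by lpush; lcu.
Qed.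

End CoactAntipode.

(** * Smash products *)

Section Smash.
Variables (k : fieldType) (H : hopfAlg k) (R : ydHopfAlg H) (E : cleftR R).
Hypothesis hM : is_module_algebra E.
Hypothesis hC : is_comodule_algebra_R E.
Local Notation mul := (@cR_mul k H R E).
Local Notation one := (@cR_one k H R E).
Local Notation acE := (@cR_act k H R E).
Local Notation rho := (@cR_coact k H R E).

Let bm : bilin mul. Proof. by case: hM => -[]. Qed.
Let ba : bilin acE. Proof. by case: hM => _ []. Qed.
Let lrho : linear rho. Proof. by case: hC => -[]. Qed.
#[local] Hint Resolve bm ba lrho : sweedler.
Let mulA : associative mul. Proof. by case: hM => -[]. Qed.
Let mul1e : left_id one mul. Proof. by case: hM => -[]. Qed.
Let mule1 : right_id one mul. Proof. by case: hM => -[]. Qed.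
Let one_neq0 : one != 0. Proof. by case: hM => -[]. Qed.
Let ac1 v : acE 1 v = v. Proof. by case: hM => _ []. Qed.
Let acM h g v : acE (h * g) v = acE h (acE g v). Proof. by case: hM => _ []. Qed.
Let acmul h e e' : acE h (mul e e') =
   \tsum_(h1 ⊗ h2 <- comul h) mul (acE h1 e) (acE h2 e').
Proof. by case: hM. Qed.
Let acone h : acE h one = counit h *: one. Proof. by case: hM. Qed.
Let rhoact h e : rho (acE h e) =
  \tsum_(h1 ⊗ h2 <- comul h) \tsum_(v ⊗ w <- rho e) (acE h1 v ⊗ act R h2 w).
Proof. by case: hC => _ ->. Qed.
Let rhomul e e' : rho (mul e e') =
  \tsum_(e ⊗ r <- rho e) \tsum_(e' ⊗ r' <- rho e') \tsum_(m ⊗ r0 <- coact R r)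
    (mul e (acE m e') ⊗ (r0 * r')).
Proof. by case: hC => _ _ ->. Qed.
Let rho1 : rho one = one ⊗ 1. Proof. by case: hC. Qed.
Let coinv e : rho e = e ⊗ 1 <-> exists c : k, e = c *: one. Proof. by case: hC. Qed.
Let rhoA (X : lmodType k) (F : E -> R -> R -> X) v : trilin F ->
  \tsum_(x ⊗ c <- rho v) \tsum_(y ⊗ d <- rho x) F y d c =
  \tsum_(x ⊗ c <- rho v) \tsum_(d ⊗ d' <- bcomul R c) F x d d'.
Proof. by apply: assocP; case: hC => -[]. Qed.
Let rho_counit (X : lmodType k) (F : E -> X) v : linear F ->
  \tsum_(x ⊗ c <- rho v) (bcounit R c *: F x) = F v.
Proof.
case: hC => -[_ _ h] _ _ _ _ lF; rewrite -{2}(h v) (tlift_lin _ _ lF).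
by apply: eq_tlift => x y; rewrite linZ.
Qed.

Ltac sw_local T ::=
  first
  [ lazymatch T with context [mul (mul _ _) _] => rewrite -mulA end
  | lazymatch T with context [mul one _] => rewrite mul1e end
  | lazymatch T with context [mul _ one] => rewrite mule1 end
  | lazymatch T with context [acE 1 _] => rewrite ac1 end
  | lazymatch T with context [acE (_ * _) _] => rewrite acM end
  | lazymatch T with context [acE _ (mul _ _)] => rewrite acmul end
  | lazymatch T with context [acE _ one] => rewrite acone end
  | lazymatch T with context [rho (mul _ _)] => rewrite rhomul end
  | lazymatch T with context [rho one] => rewrite rho1 end
  | lazymatch T with context [rho (acE _ _)] => rewrite rhoact end ].
Ltac sw_assoc_local ::= refine (rhoA _ _).
Ltac sw_counit_local ::= refine (rho_counit _ _).

Local Notation smul := (smash_mul mul acE).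
Local Notation srho := (smash_coact rho).

Lemma smash_mul_bilin : bilin smul.
Proof. by rewrite /smash_mul; sbilin. Qed.

Lemma smash_coact_lin : linear srho.
Proof. by rewrite /smash_coact; slin. Qed.

Lemma smash_mulA : associative smul.
Proof. by move=> x y z; rewrite /smash_mul; sw. Qed.

Lemma smash_mul1 : left_id (one ⊗ 1) smul.
Proof.
by move=> x; rewrite /smash_mul; lpush; lcu; lpush; apply: tlift_id.
Qed.

Lemma smash_1mul : right_id (one ⊗ 1) smul.
Proof.
by move=> x; rewrite /smash_mul; lpush; lcu; lpush; apply: tlift_id.
Qed.

Lemma smash_one_neq0 : one ⊗ 1 != 0 :> (E ⊗ H)%type.
Proof.
apply/eqP => h; have := congr1 (tlift (fun (e : E) (h : H) => counit h *: e)) h.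
have b : bilin (fun (e : E) (h : H) => counit h *: e) by sbilin.
by rewrite tliftE // (tlift0 b) counit1 scale1r => /eqP; apply/negP.
Qed.

(** On the side that applies the coproduct of R # H, r_(0) is comultiplied next to the coefficient
    r_(-1); colinearity of Δ_R distributes that coefficient over the two factors. *)
Lemma smash_coactA v :
  \tsum_(x ⊗ c <- srho v) \tsum_(y ⊗ d <- srho x) (y ⊗ (d ⊗ c)) =
  \tsum_(x ⊗ c <- srho v) \tsum_(d ⊗ d' <- smash_coact (bcomul R) c)
    (x ⊗ (d ⊗ d')).
Proof.
by rewrite /smash_coact; lpush; rpush; symmetry; lcb; lpush; rcomb; lcomb; sw_strip.
Qed.

(** H-linearity of ρ produces the coaction of an element h · r, and the Yetter-Drinfeld condition
    moves h past it. *)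
Lemma smash_coactM x y : srho (smul x y) =
  \tsum_(e ⊗ b <- srho x) \tsum_(e' ⊗ b' <- srho y)
    (smul e e' ⊗ smash_mul *%R (act R) b b').
Proof.
rewrite /smash_coact /smash_mul; lpush; rpush; lcomb; lsink; lyd; lpush; rcomb.
by sw_strip.
Qed.

Lemma smash_coact1 : srho (one ⊗ 1) = (one ⊗ 1) ⊗ (1 ⊗ 1).
Proof. by rewrite /smash_coact; lpush. Qed.

Lemma smash_coact_counit x : \tsum_(y ⊗ b <- srho x)
  ((\tsum_(r ⊗ h <- b) (bcounit R r * counit h)) *: y) = x.
Proof.
by rewrite /smash_coact; lpush; lcu; lpush; lcu; apply: tlift_id.
Qed.

Lemma smash_coinv x : srho x = x ⊗ (1 ⊗ 1) <-> exists c : k, x = c *: (one ⊗ 1).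
Proof.
split=> [h|[c ->]]; last first.
  rewrite (linZ smash_coact_lin) smash_coact1 (linZ (g := fun y => y ⊗ (1 ⊗ 1))) //.
  by slin.
(* The counit on the H-leg of the first factor and on the R-leg of the second leaves x on one side
   and an element e' ⊗ 1 on the other. *)
have /= h1 := congr1 (tlift (fun y b => \tsum_(e ⊗ m <- y) \tsum_(r ⊗ g <- b)
  (counit m *: (bcounit R r *: (e ⊗ g))))) h.
have {}h1 : x = (\tsum_(e ⊗ g <- x) (counit g *: e)) ⊗ 1.
  refine (eq_trans _ (eq_trans h1 _)).
    rewrite /smash_coact; symmetry; lpush; lcu; lpush; lcu; lpush; lcu.
    exact: tlift_id.
  by lpush; rpush.
set e' := tlift _ _ in h1; rewrite {}h1 in h *.
(* The counit on both H-legs recovers ρ(e') = e' ⊗ 1, so e' is a scalar by the coinvariants of E. *)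
have /= h2 := congr1 (tlift (fun y b => \tsum_(e ⊗ m <- y) \tsum_(r ⊗ g <- b)
  (counit m *: (counit g *: (e ⊗ r))))) h.
have /coinv [c ->] : rho e' = e' ⊗ 1.
  refine (eq_trans _ (eq_trans h2 _)).
    by rewrite /smash_coact; symmetry; lpush; lcu; lpush; apply: tlift_id.
  by lpush; rpush.
exists c; exact: (linZ (bilinl _ (tens_bilin _ _))).
Qed.

Section Sec.
Hypothesis hS : is_section_R E.
Local Notation gam := (@cR_sec k H R E).
Variable gbar : R -> E.
Hypothesis lgbar : linear gbar.
Hypothesis hgbar : is_conv_inverse (bcomul R) (bcounit R) mul one gam gbar.

Let lgam : linear gam. Proof. by case: hS. Qed.
Let gam1 : gam 1 = one. Proof. by case: hS. Qed.
Let gamact h r : gam (act R h r) = acE h (gam r). Proof. by case: hS. Qed.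
Let rhogam r : rho (gam r) = \tsum_(r1 ⊗ r2 <- bcomul R r) (gam r1 ⊗ r2).
Proof. by case: hS. Qed.
#[local] Hint Resolve lgam lgbar smash_mul_bilin : sweedler.

Local Notation sec := (fun x : (R ⊗ H)%type =>
  \tsum_(r ⊗ h <- x) (gam r ⊗ h) : (E ⊗ H)%type).

Definition smash_sec_inv (x : (R ⊗ H)%type) : (E ⊗ H)%type :=
  \tsum_(r ⊗ h <- x) \tsum_(m ⊗ r0 <- coact R r)
    smul (one ⊗ antipode (m * h)) (gbar r0 ⊗ 1).

Lemma smash_sec_lin : linear sec.
Proof. by slin. Qed.

Lemma smash_sec_inv_lin : linear smash_sec_inv.
Proof. by rewrite /smash_sec_inv; slin. Qed.

Lemma smash_sec_coact x : srho (sec x) =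
  \tsum_(b1 ⊗ b2 <- smash_coact (bcomul R) x) (sec b1 ⊗ b2).
Proof.
rewrite /smash_coact; lpush; rpush; lcomb; rcomb.
by lat ltac:(rewrite rhogam; reflexivity); lpush; sw_strip.
Qed.

Lemma smash_mul_r a h g : smul (a ⊗ h) (one ⊗ g) = a ⊗ (h * g).
Proof. by rewrite /smash_mul; lpush; lcu. Qed.

Lemma smash_mul_l a b g : smul (a ⊗ 1) (b ⊗ g) = mul a b ⊗ g.
Proof. by rewrite /smash_mul; lpush. Qed.

Lemma smash_sec1 : sec (1 ⊗ 1) = one ⊗ 1.
Proof. by cbv beta; rewrite tliftE ?gam1 //; sbilin. Qed.

Lemma smash_sec_balanced r h h' h'' :
  sec (smash_mul *%R (act R) (smash_mul *%R (act R) (1 ⊗ h) (r ⊗ h')) (1 ⊗ h'')) =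
  smul (smul (sec (1 ⊗ h)) (sec (r ⊗ h'))) (sec (1 ⊗ h'')).
Proof.
cbv beta; rewrite !tliftE; try (by sbilin); rewrite !gam1.
rewrite /smash_mul; lpush; rpush; lcu; rcu.
by apply: eq_tlift => u v; rewrite gamact.
Qed.

(** Colinearity of Δ_R merges the coaction coefficients of r_(1) and r_(2) into one r_(-1); then γ̄
    * γ collapses on r_(0), and S(h_(1)) h_(2) is all that remains. *)
Lemma smash_sec_invl x :
  \tsum_(a ⊗ b <- smash_coact (bcomul R) x) smul (smash_sec_inv a) (sec b) =
  (\tsum_(r ⊗ h <- x) (bcounit R r * counit h)) *: (one ⊗ 1).
Proof.
rewrite /smash_coact /smash_sec_inv; lpush; rpush; apply: eq_tlift => r h.
transitivity (\tsum_(h1 ⊗ h2 <- comul h) \tsum_(m ⊗ r0 <- coact R r)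
  \tsum_(a ⊗ b <- bcomul R r0)
    smul (one ⊗ antipode (m * h1)) (mul (gbar a) (gam b) ⊗ h2)).
  symmetry; lcb; symmetry; sw_strip.
  by rewrite -smash_mulA smash_mul_l.
transitivity (\tsum_(h1 ⊗ h2 <- comul h) \tsum_(m ⊗ r0 <- coact R r)
  (bcounit R r0 *: smul (one ⊗ antipode (m * h1)) (one ⊗ h2))).
  apply: eq_tlift => h1 h2; apply: eq_tlift => m r0.
  rewrite -(tlift_lin (g := fun z => smul _ (z ⊗ h2))); last by slin.
  rewrite (hgbar r0).2 (linZ (g := fun z => smul _ (z ⊗ h2))) //; slin.
lcu; lat ltac:(rewrite smash_mul_r mul1r; reflexivity).
by rewrite tlift_scale; lanti.
Qed.

(** Here both coaction coefficients come from r_(2), so the H-part cancels first and γ * γ̄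
    afterwards. *)
Lemma smash_sec_invr x :
  \tsum_(a ⊗ b <- smash_coact (bcomul R) x) smul (sec a) (smash_sec_inv b) =
  (\tsum_(r ⊗ h <- x) (bcounit R r * counit h)) *: (one ⊗ 1).
Proof.
rewrite /smash_coact /smash_sec_inv; lpush; rpush; apply: eq_tlift => r h.
transitivity (\tsum_(r1 ⊗ r2 <- bcomul R r) (counit h *:
    smul (gam r1 ⊗ 1) (gbar r2 ⊗ 1))).
  apply: eq_tlift => r1 r2.
  rewrite -(coact_antipode (F := fun a w => smul (gam r1 ⊗ a) (gbar w ⊗ 1)));
    last by sbilin.
  by sw_strip; rewrite smash_mulA smash_mul_r.
rewrite tlift_scale; lat ltac:(rewrite smash_mul_l; reflexivity).
rewrite scale_swap -(tlift_lin (g := fun z => z ⊗ 1)); last by slin.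
by rewrite (hgbar r).1 (linZ (g := fun z => z ⊗ 1)) //; slin.
Qed.

End Sec.

End Smash.

Section SmashCleft.
Variables (k : fieldType) (H : hopfAlg k) (R : ydHopfAlg H) (E : cleftR R).

Lemma smash_comodule_algebra : is_module_algebra E -> is_comodule_algebra_R E ->
  is_comodule_algebra_B (smash E).
Proof.
move=> hM hC; split=> /=.
- split; [exact: smash_mul_bilin|exact: smash_mulA|exact: smash_mul1
  |exact: smash_1mul|exact: smash_one_neq0].
- split; [exact: smash_coact_lin|exact: smash_coactA|exact: smash_coact_counit].
- exact: smash_coactM.
- exact: smash_coact1.
- exact: smash_coinv.
Qed.

Lemma smash_cleft : is_cleftR E -> is_cleftB (smash E) /\ is_H_balanced (smash E).
Proof.
move=> [hM hC hS]; split; last first.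
  by move=> r h h' h''; apply: smash_sec_balanced.
split; first exact: smash_comodule_algebra.
have [g [lg _ hg]] : exists g : R -> E,
   [/\ linear g, forall h r, g (act R h r) = cR_act h (g r)
     & is_conv_inverse (bcomul R) (bcounit R)
              (@cR_mul _ _ _ E) (cR_one E) (@cR_sec _ _ _ E) g] by case: hS.
split=> /=.
- exact: smash_sec_lin.
- exact: smash_sec_coact.
- exists (smash_sec_inv g); first exact: smash_sec_inv_lin.
  by move=> c; split; [exact: smash_sec_invr|exact: smash_sec_invl].
- exact: smash_sec1.
Qed.

End SmashCleft.

(** * Cleft objects and cocycles *)

Section Bialgebra.
Variable k : fieldType.

Definition is_bialgebra (B : bialgData k) : Prop :=
  [/\ is_coalgebra (@b_comul k B) (@b_counit k B),
      is_algebra (@b_mul k B) (b_one B),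
      forall x y : B, b_comul (b_mul x y) = \tsum_(x1 ⊗ x2 <- b_comul x)
        \tsum_(y1 ⊗ y2 <- b_comul y) (b_mul x1 y1 ⊗ b_mul x2 y2),
      b_comul (b_one B) = b_one B ⊗ b_one B
    & (forall x y : B, b_counit (b_mul x y) = b_counit x * b_counit y)
      /\ b_counit (b_one B) = 1].

Lemma scale_inj (V : lmodType k) (v : V) (c d : k) : v != 0 -> c *: v = d *: v -> c = d.
Proof.
move=> /negbTE v0 /eqP; rewrite -subr_eq0 -scalerBl scaler_eq0 v0 orbF subr_eq0.
by move/eqP.
Qed.

Lemma BB_convE (B : bialgData k) (f g : (B ⊗ B)%type -> k) t :
  linear (@b_comul k B) -> scalar f -> scalar g ->
  \tsum_(u ⊗ v <- BB_comul t) (f u * g v) =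
  \tsum_(x ⊗ y <- t) \tsum_(x1 ⊗ x2 <- b_comul x) \tsum_(y1 ⊗ y2 <- b_comul y)
    (f (x1 ⊗ y1) *: (g (x2 ⊗ y2) : k^o)) :> k^o.
Proof.
move=> lD lf lg.
have {}lf : linear (f : _ -> k^o) by exact: lf.
have {}lg : linear (g : _ -> k^o) by exact: lg.
change (@tlift k _ _ k^o (fun u v => f u *: (g v : k^o)) (BB_comul t) =
  \tsum_(x ⊗ y <- t) \tsum_(x1 ⊗ x2 <- b_comul x) \tsum_(y1 ⊗ y2 <- b_comul y)
    (f (x1 ⊗ y1) *: (g (x2 ⊗ y2) : k^o)) :> k^o).
by rewrite /BB_comul; lpush.
Qed.

End Bialgebra.

Section Cleft.
Variables (k : fieldType) (B : bialgData k) (E : cleftB B).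
Hypothesis hB : is_bialgebra B.
Hypothesis hE : is_cleftB E.
Local Notation D := (@b_comul k B).
Local Notation e := (@b_counit k B).
Local Notation mulB := (@b_mul k B).
Local Notation oneB := (@b_one k B).
Local Notation mul := (@cB_mul k B E).
Local Notation one := (@cB_one k B E).
Local Notation rho := (@cB_coact k B E).
Local Notation del := (@cB_sec k B E).

Let hD : is_coalgebra D e. Proof. by case: hB. Qed.
Let lD : linear D. Proof. exact: coalg_lin hD. Qed.
Let le : linear (e : B -> k^o). Proof. exact: coalg_linc hD. Qed.
Let bmB : bilin mulB. Proof. by case: hB => _ []. Qed.
Let mulBA : associative mulB. Proof. by case: hB => _ []. Qed.
Let mul1B : left_id oneB mulB. Proof. by case: hB => _ []. Qed.
Let mulB1 : right_id oneB mulB. Proof. by case: hB => _ []. Qed.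
Let D1 : D oneB = oneB ⊗ oneB. Proof. by case: hB. Qed.
Let DM x y : D (mulB x y) = \tsum_(x1 ⊗ x2 <- D x)
        \tsum_(y1 ⊗ y2 <- D y) (mulB x1 y1 ⊗ mulB x2 y2).
Proof. by case: hB. Qed.
Let eM x y : e (mulB x y) = e x * e y. Proof. by case: hB => _ _ _ _ []. Qed.
Let e1 : e oneB = 1. Proof. by case: hB => _ _ _ _ []. Qed.

Let bm : bilin mul. Proof. by case: hE => -[[]]. Qed.
Let mulA : associative mul. Proof. by case: hE => -[[]]. Qed.
Let mul1e : left_id one mul. Proof. by case: hE => -[[]]. Qed.
Let mule1 : right_id one mul. Proof. by case: hE => -[[]]. Qed.
Let one_neq0 : one != 0. Proof. by case: hE => -[[]]. Qed.
Let lrho : linear rho. Proof. by case: hE => -[_ []]. Qed.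
Let rhomul x y : rho (mul x y) = \tsum_(x ⊗ b <- rho x) \tsum_(x' ⊗ b' <- rho y)
          (mul x x' ⊗ mulB b b').
Proof. by case: hE => -[_ _ ->]. Qed.
Let rho1 : rho one = one ⊗ oneB. Proof. by case: hE => -[]. Qed.
Let coinv x : rho x = x ⊗ oneB <-> exists c : k, x = c *: one.
Proof. by case: hE => -[]. Qed.
Let rhoA (X : lmodType k) (F : E -> B -> B -> X) v : trilin F ->
  \tsum_(x ⊗ c <- rho v) \tsum_(y ⊗ d <- rho x) F y d c =
  \tsum_(x ⊗ c <- rho v) \tsum_(d ⊗ d' <- D c) F x d d'.
Proof. by apply: assocP; case: hE => -[_ []]. Qed.
Let rho_counit (X : lmodType k) (F : E -> X) v : linear F ->
  \tsum_(x ⊗ c <- rho v) (e c *: F x) = F v.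
Proof.
case: hE => -[_ [_ _ h] _ _ _] _ lF; rewrite -{2}(h v) (tlift_lin _ _ lF).
by apply: eq_tlift => x y; rewrite linZ.
Qed.
Let ldel : linear del. Proof. by case: hE => _ []. Qed.
Let del1 : del oneB = one. Proof. by case: hE => _ []. Qed.
Let rhodel b : rho (del b) = \tsum_(b1 ⊗ b2 <- D b) (del b1 ⊗ b2).
Proof. by case: hE => _ []. Qed.

Variable dbar : B -> E.
Hypothesis ldbar : linear dbar.
Hypothesis hdbar : is_conv_inverse D e mul one del dbar.
#[local] Hint Resolve lD le bmB bm lrho ldel ldbar : sweedler.

Ltac sw_local T ::=
  first
  [ lazymatch T with context [mul (mul _ _) _] => rewrite -mulA end
  | lazymatch T with context [mul one _] => rewrite mul1e end
  | lazymatch T with context [mul _ one] => rewrite mule1 end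
  | lazymatch T with context [rho (mul _ _)] => rewrite rhomul end
  | lazymatch T with context [rho one] => rewrite rho1 end
  | lazymatch T with context [rho (del _)] => rewrite rhodel end
  | lazymatch T with context [del oneB] => rewrite del1 end
  | lazymatch T with context [D (mulB _ _)] => rewrite DM end
  | lazymatch T with context [D oneB] => rewrite D1 end
  | lazymatch T with context [e (mulB _ _)] => rewrite eM end
  | lazymatch T with context [e oneB] => rewrite e1 end
  | lazymatch T with context [mulB (mulB _ _) _] => rewrite -mulBA end
  | lazymatch T with context [mulB oneB _] => rewrite mul1B end
  | lazymatch T with context [mulB _ oneB] => rewrite mulB1 end ].
Ltac sw_assoc_local ::= first [refine (coassoc hD _ _) | refine (rhoA _ _)].
Ltac sw_counit_local ::=
  first [ refine (counitl hD _ _) | refine (counitr hD _ _)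
        | refine (rho_counit _ _) ].

Definition cleft_proj (x : E) : E := \tsum_(y ⊗ b <- rho x) mul y (dbar b).

(** This is ρ applied to δ * δ̄ = ε 1 and expanded by multiplicativity of ρ and colinearity of δ. *)
Lemma rho_dbar (X : lmodType k) (F : E -> B -> X) b : bilin F ->
  \tsum_(b1 ⊗ b' <- D b) \tsum_(b2 ⊗ b3 <- D b') \tsum_(y ⊗ z <- rho (dbar b3))
    F (mul (del b1) y) (mulB b2 z) = e b *: F one oneB.
Proof.
move=> bF.
transitivity (tlift F (rho (\tsum_(b1 ⊗ b2 <- D b) mul (del b1) (dbar b2)))).
  by rpush; rcomb; sw_strip.
by rewrite (hdbar b).1; lpush.
Qed.

(* ρ(δ̄(b)) is determined as the inverse of ρ(δ(b)): inserting ε(b_(1)) =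
   δ̄(b_(1)) δ(b_(2)) makes [rho_dbar] applicable. *)
Lemma cleft_proj_coinv x : rho (cleft_proj x) = cleft_proj x ⊗ oneB.
Proof.
rewrite /cleft_proj; lpush; lcomb; rpush; apply: eq_tlift => y b; symmetry.
rewrite -(counitr hD (F := fun b => mul y (dbar b) ⊗ oneB)); last by slin.
transitivity (\tsum_(b1 ⊗ b2 <- D b)
   \tsum_(c1 ⊗ c' <- D b2) \tsum_(c2 ⊗ c3 <- D c') \tsum_(u ⊗ z <- rho (dbar c3))
    (mul y (mul (dbar b1) (mul (del c1) u)) ⊗ mulB c2 z)).
  apply: eq_tlift => b1 b2.
  rewrite (rho_dbar (F := fun v w => mul y (mul (dbar b1) v) ⊗ w)) ?mule1 //.
  by sbilin.
rewrite -(coassoc hD (F := fun b1 c1 c' => \tsum_(c2 ⊗ c3 <- D c')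
  \tsum_(u ⊗ z <- rho (dbar c3))
    (mul y (mul (dbar b1) (mul (del c1) u)) ⊗ mulB c2 z))); last by strilin.
transitivity (\tsum_(a ⊗ c <- D b) (e a *: \tsum_(c2 ⊗ c3 <- D c)
  \tsum_(u ⊗ z <- rho (dbar c3)) (mul y u ⊗ mulB c2 z))).
  apply: eq_tlift => a c.
  refine (eq_trans _ (eq_trans (conv_invl (F := fun v => \tsum_(c2 ⊗ c3 <- D c)
    \tsum_(u ⊗ z <- rho (dbar c3)) (mul y (mul v u) ⊗ mulB c2 z)) a hdbar _) _)).
  - by apply: eq_tlift => b1 c1; rpush.
  - by slin.
  - by congr (_ *: _); cbv beta; lat ltac:(rewrite mul1e; reflexivity).
by lcu.
Qed.

Lemma cleft_formP : exists2 om : E -> k, scalar om &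
  forall x, cleft_proj x = om x *: one.
Proof.
have h x : exists c : k, cleft_proj x = c *: one by apply/coinv/cleft_proj_coinv.
(* The scalar is chosen pointwise; it is unique because 1 ≠ 0, and uniqueness makes it linear in
   x. *)
exists (fun x => projT1 (cid (h x))) => [a x y|x]; last exact: projT2 (cid (h x)).
apply: (scale_inj one_neq0); rewrite -(projT2 (cid (h _))) scalerDl -scalerA.
rewrite -(projT2 (cid (h x))) -(projT2 (cid (h y))).
have : linear cleft_proj by rewrite /cleft_proj; slin.
by apply.
Qed.

Variable om : E -> k.
Hypothesis lom : scalar om.
Hypothesis omP : forall x, cleft_proj x = om x *: one.
Let lom' : linear (om : E -> k^o). Proof. exact: lom. Qed.
#[local] Hint Resolve lom' : sweedler.

Lemma om_sec b : om (del b) = e b.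
Proof.
apply: (scale_inj one_neq0); rewrite -omP /cleft_proj rhodel.
by lpush; rewrite (hdbar b).1.
Qed.

Lemma om_one : om one = 1.
Proof. by rewrite -del1 om_sec e1. Qed.

Lemma om_decomp x : \tsum_(y ⊗ b <- rho x) (om y *: del b) = x.
Proof.
transitivity (\tsum_(y ⊗ b <- rho x) mul (cleft_proj y) (del b)).
  by apply: eq_tlift => y b; rewrite omP; rpush.
rewrite /cleft_proj; lpush; lcomb.
transitivity (\tsum_(y ⊗ b <- rho x) e b *: y).
  apply: eq_tlift => y b.
  rewrite (conv_invl (F := fun z => mul y z) b hdbar) ?mule1 //.
  by slin.
by lcu.
Qed.

Lemma om_decompM x y : mul (del x) (del y) =
  \tsum_(x1 ⊗ x2 <- D x) \tsum_(y1 ⊗ y2 <- D y)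
    (om (mul (del x1) (del y1)) *: del (mulB x2 y2)).
Proof. by rewrite -[LHS]om_decomp; lpush. Qed.

Local Notation sig x y := (om (mul (del x) (del y))).

Lemma conv_invM (X : lmodType k) (F : E -> X) x y : linear F ->
  \tsum_(x1 ⊗ x2 <- D x) \tsum_(y1 ⊗ y2 <- D y)
    F (mul (del (mulB x1 y1)) (dbar (mulB x2 y2))) = e x *: (e y *: F one).
Proof.
move=> lF; rewrite scalerA -eM -(conv_invr _ hdbar lF).
by symmetry; lpush.
Qed.

(** The familiar formula for the cocycle of a section. Written with δ̄ on the right, it lets σ
    cancel against [cleft_inv] inside E. *)
Lemma sig_one x y : sig x y *: one =
  \tsum_(x1 ⊗ x2 <- D x) \tsum_(y1 ⊗ y2 <- D y)
    mul (mul (del x1) (del y1)) (dbar (mulB x2 y2)).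
Proof.
symmetry; lat ltac:(rewrite om_decompM; reflexivity); lpush; lcomb.
transitivity (\tsum_(x1 ⊗ x2 <- D x) \tsum_(y1 ⊗ y2 <- D y)
    (e x2 *: (e y2 *: (sig x1 y1 *: one)))).
  apply: eq_tlift => x1 x2; symmetry.
  transitivity (\tsum_(y1 ⊗ y2 <- D y) \tsum_(x3 ⊗ x4 <- D x2)
     \tsum_(y3 ⊗ y4 <- D y2) (sig x1 y1 *: mul (del (mulB x3 y3)) (dbar (mulB x4 y4)))).
    apply: eq_tlift => y1 y2.
    by rewrite (conv_invM (F := fun z => sig x1 y1 *: z)) //; slin.
  by sw_strip.
by lcu.
Qed.

(** Kept with values in E: its products are simplified there, and ω is applied only at the end. *)
Definition cleft_inv x y := \tsum_(x1 ⊗ x2 <- D x) \tsum_(y1 ⊗ y2 <- D y)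
  mul (del (mulB x1 y1)) (mul (dbar y2) (dbar x2)).

Lemma sig_inv x y : \tsum_(x1 ⊗ x2 <- D x) \tsum_(y1 ⊗ y2 <- D y)
   (sig x1 y1 *: cleft_inv x2 y2) = (e x * e y) *: one.
Proof.
transitivity (\tsum_(x1 ⊗ x2 <- D x) \tsum_(y1 ⊗ y2 <- D y)
   mul (mul (del x1) (del y1)) (mul (dbar y2) (dbar x2))).
  rewrite /cleft_inv; symmetry; lat ltac:(rewrite om_decompM; reflexivity).
  by lpush; lcomb; rpush; sw_strip.
transitivity (\tsum_(x1 ⊗ x2 <- D x) (e y *: mul (del x1) (dbar x2))).
  apply: eq_tlift => x1 x2.
  have := conv_invr (F := fun z => mul (del x1) (mul z (dbar x2))) y hdbar.
  rewrite mul1e => <-; last by slin.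
  by lpush; rpush.
rewrite (conv_invr (F := fun z => e y *: z) x hdbar); last by slin.
by rewrite scalerA.
Qed.

Lemma conv_invl3 (X : lmodType k) (F : E -> B -> X) b : bilin F ->
  \tsum_(b1 ⊗ b' <- D b) \tsum_(b2 ⊗ b3 <- D b') F (mul (dbar b1) (del b2)) b3 =
  F one b.
Proof.
move=> bF; rewrite -(coassoc hD (F := fun b1 b2 b3 => F (mul (dbar b1) (del b2)) b3));
  last by strilin.
transitivity (\tsum_(a ⊗ c <- D b) (e a *: F one c)).
  apply: eq_tlift => a c.
  by rewrite (conv_invl (F := fun z => F z c) a hdbar) //; slin.
by lcu.
Qed.

Lemma inv_sig x y : \tsum_(x1 ⊗ x2 <- D x) \tsum_(y1 ⊗ y2 <- D y)
   (sig x2 y2 *: cleft_inv x1 y1) = (e x * e y) *: one.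
Proof.
transitivity (\tsum_(x1 ⊗ x2 <- D x) \tsum_(y1 ⊗ y2 <- D y)
   mul (cleft_inv x1 y1) (sig x2 y2 *: one)).
  by rpush.
(* The summand becomes δ(x_(1) y_(1)) δ̄(y_(2)) δ̄(x_(2)) δ(x_(3)) δ(y_(3)) δ̄(x_(4) y_(4)). It
   cancels from the inside, the x-factors before the y-factors. *)
lat ltac:(rewrite sig_one; reflexivity).
rewrite /cleft_inv; lpush; lcomb.
transitivity (\tsum_(x1 ⊗ x2 <- D x) \tsum_(y1 ⊗ y2 <- D y)
    mul (del (mulB x1 y1)) (dbar (mulB x2 y2))); last first.
  by rewrite (conv_invM (F := id)) // scalerA.
apply: eq_tlift => x1 x2; symmetry; refine (eq_trans _ _); last first.
  by symmetry; sw_float (D y).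
apply: eq_tlift => y1 y2; symmetry.
transitivity (\tsum_(y3 ⊗ y' <- D y2) \tsum_(y4 ⊗ y5 <- D y') mul (del (mulB x1 y1))
   (mul (mul (dbar y3) (del y4)) (dbar (mulB x2 y5)))); last first.
  rewrite (conv_invl3 (F := fun z y => mul (del (mulB x1 y1)) (mul z (dbar (mulB x2 y)))))
    ?mul1e //; sbilin.
transitivity (\tsum_(y3 ⊗ y' <- D y2) \tsum_(y4 ⊗ y5 <- D y')
   \tsum_(x3 ⊗ x' <- D x2) \tsum_(x4 ⊗ x5 <- D x') mul (del (mulB x1 y1))
   (mul (dbar y3) (mul (mul (dbar x3) (del x4)) (mul (del y4) (dbar (mulB x5 y5)))))).
  by rpush; sw_strip.
apply: eq_tlift => y3 y'; apply: eq_tlift => y4 y5.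
rewrite (conv_invl3 (F := fun z x => mul (del (mulB x1 y1)) (mul (dbar y3)
   (mul z (mul (del y4) (dbar (mulB x y5))))))) ?mul1e ?mulA //; sbilin.
Qed.

Lemma sig_bilin : bilin ((fun x y => sig x y) : B -> B -> k^o).
Proof. by sbilin. Qed.

(** Together with [sigMr] this identifies each side of the cocycle condition with ω of a triple
    product, so the condition is associativity of E. *)
Lemma sigMl x y z : \tsum_(x1 ⊗ x2 <- D x) \tsum_(y1 ⊗ y2 <- D y)
    (sig x1 y1 *: (sig (mulB x2 y2) z : k^o)) =
  om (mul (mul (del x) (del y)) (del z)) :> k^o.
Proof. by symmetry; rewrite om_decompM; lpush. Qed.

Lemma sigMr x y z : \tsum_(y1 ⊗ y2 <- D y) \tsum_(z1 ⊗ z2 <- D z)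
    (sig y1 z1 *: (sig x (mulB y2 z2) : k^o)) =
  om (mul (del x) (mul (del y) (del z))) :> k^o.
Proof. by symmetry; rewrite [mul (del y) _]om_decompM; lpush. Qed.

Definition cleft_cocycle (t : (B ⊗ B)%type) : k := \tsum_(x ⊗ y <- t) sig x y.

Lemma cleft_cocycleE x y : cleft_cocycle (x ⊗ y) = sig x y.
Proof. exact: (tliftE sig_bilin). Qed.

Lemma cleft_cocycle_ZB : ZB cleft_cocycle.
Proof.
have lz : bilin (fun x y => om (cleft_inv x y) : k^o).
  by rewrite /cleft_inv; sbilin.
split.
- exact: (tlift_linear sig_bilin).
- exists (fun t => \tsum_(x ⊗ y <- t) om (cleft_inv x y)).
    exact: (tlift_linear lz).
  have h (f g : B -> B -> k^o) : bilin f -> bilin g ->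
      (forall x y, \tsum_(x1 ⊗ x2 <- D x) \tsum_(y1 ⊗ y2 <- D y)
        (f x1 y1 *: g x2 y2) = e x * e y) ->
      forall t, \tsum_(u ⊗ v <- BB_comul t) (tlift f u * tlift g v) = BB_counit t.
    move=> bf bg hfg t.
    rewrite (BB_convE t lD (tlift_linear bf) (tlift_linear bg)).
    apply: eq_tlift => x y; rewrite -hfg.
    apply: eq_tlift => x1 x2; apply: eq_tlift => y1 y2.
    by rewrite !tliftE.
  have h1 := h _ _ sig_bilin lz; have h2 := h _ _ lz sig_bilin.
  move=> t; split; [apply: h1 => x y | apply: h2 => x y].
  - rewrite -[RHS](mulr1) -om_one -[_ * om one]/(_ *: (om one : k^o)) -(linZ lom').
    by rewrite -sig_inv; rpush.
  - rewrite -[RHS](mulr1) -om_one -[_ * om one]/(_ *: (om one : k^o)) -(linZ lom').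
    rewrite -inv_sig; rpush; do 2 (apply: eq_tlift => ? ?).
    exact: mulrC.
- by rewrite cleft_cocycleE !del1 mul1e om_one.
- move=> x y z; transitivity (om (mul (mul (del x) (del y)) (del z))).
    rewrite -sigMl; apply: eq_tlift => x1 x2; apply: eq_tlift => y1 y2.
    by rewrite !cleft_cocycleE.
  rewrite -mulA -sigMr; apply: eq_tlift => y1 y2; apply: eq_tlift => z1 z2.
  by rewrite !cleft_cocycleE.
Qed.

Lemma twist_cleft_iso : isoB (twistB cleft_cocycle) E.
Proof.
exists del; split=> /=.
- split; first exact: ldel.
  (* The inverse of δ is read off the decomposition x = ω(x_(0)) δ(x_(1)). *)
  exists (fun x => \tsum_(y ⊗ b <- rho x) (om y *: b)) => [b|x].
    rewrite rhodel; lpush; lat ltac:(rewrite om_sec; reflexivity).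
    by rewrite (counitl hD (F := id)).
  by lpush; apply: om_decomp.
- split; last exact: del1.
  move=> x y; rewrite om_decompM; lpush.
  apply: eq_tlift => x1 x2; apply: eq_tlift => y1 y2.
  by rewrite cleft_cocycleE.
- exact: rhodel.
- by [].
Qed.

End Cleft.

(** The convolution inverse of the section is hidden here. Since the section is onto, ω δ = ε is
    enough to compute the cocycle of a concrete cleft object. *)
Lemma cleftB_form (k : fieldType) (B : bialgData k) (E : cleftB B) :
  is_bialgebra B -> is_cleftB E ->
  exists om : E -> k,
    [/\ scalar om, forall b, om (cB_sec E b) = b_counit b,
        ZB (cleft_cocycle om) & isoB (twistB (cleft_cocycle om)) E].
Proof.
move=> hB hE.
have [g lg hg] : exists2 g : B -> E, linear g
        & is_conv_inverse (@b_comul k B) (@b_counit k B)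
            (@cB_mul k B E) (cB_one E) (@cB_sec k B E) g by case: hE => _ [].
have [om lom omP] := cleft_formP hB hE lg hg.
exists om; split=> //.
- by move=> b; apply: om_sec omP b.
- exact: (cleft_cocycle_ZB hB hE lg hg lom omP).
- exact: (twist_cleft_iso hB hE lg hg lom omP).
Qed.

Ltac sw_local T ::= fail.
Ltac sw_assoc_local ::= fail.
Ltac sw_counit_local ::= fail.

Lemma linear_form (k : fieldType) (V : lmodType k) (f : V -> k) :
  scalar f -> linear (f : V -> k^o).
Proof. by []. Qed.

(** A convolution idempotent with a right inverse is the unit. Its use is to pass from σ(1, 1) = 1
    to σ(1, x) = ε(x), and likewise for π. *)
Lemma idempotent_form (k : fieldType) (C : lmodType k) (D : C -> (C ⊗ C)%type)
    (e f g : C -> k) : is_coalgebra D e -> scalar f -> scalar g ->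
  (forall t, f t = \tsum_(t1 ⊗ t2 <- D t) (f t1 * f t2)) ->
  (forall t, \tsum_(t1 ⊗ t2 <- D t) (f t1 * g t2) = e t) ->
  forall t, f t = e t.
Proof.
move=> hD /linear_form lf /linear_form lg ff fg t; rewrite -[RHS]fg.
transitivity (\tsum_(t1 ⊗ t2 <- D t) (e t2 *: (f t1 : k^o))).
  by symmetry; apply: (counitr hD (F := f : C -> k^o)).
transitivity (\tsum_(t1 ⊗ t2 <- D t) \tsum_(t3 ⊗ t4 <- D t2)
   (f t1 *: (f t3 *: (g t4 : k^o)))).
  apply: eq_tlift => t1 t2; rewrite tlift_scale.
  by rewrite [LHS]mulrC; congr (_ * _); rewrite -fg.
rewrite -(coassoc hD (F := fun a b c => f a *: (f b *: (g c : k^o)))); last by strilin.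
apply: eq_tlift => u t4; rewrite (ff u).
transitivity ((\tsum_(t1 ⊗ t2 <- D u) (f t1 * f t2)) *: (g t4 : k^o)) => //.
by rewrite tliftZl; apply: eq_tlift => t1 t2; exact: mulrA.
Qed.

(** * Twisting R by a braided cocycle *)

Section Twist.
Variables (k : fieldType) (H : hopfAlg k) (R : ydHopfAlg H) (X : lmodType k).
Implicit Types (f g : (R ⊗ R)%type -> k) (F : R -> R -> X).

(** The convolution product f * F over the coalgebra R ⊗ R: for F the multiplication it is the
    product of k #_f R, for F a form it is the convolution of forms. *)
Definition twist f F (r s : R) : X :=
  \tsum_(r1 ⊗ r2 <- bcomul R r) \tsum_(s1 ⊗ s2 <- bcomul R s)
  \tsum_(m ⊗ r20 <- coact R r2) (f (r1 ⊗ act R m s1) *: F r20 s2).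

Lemma twist_bilin f F : scalar f -> bilin F -> bilin (twist f F).
Proof. by move=> /linear_form lf bF; rewrite /twist; sbilin. Qed.

(** An H-linear form absorbs the part of h that reaches it, once the Yetter-Drinfeld condition has
    moved h past the coaction in the braiding. *)
Lemma twist_act f F (h : H) r s : scalar f -> bilin F -> RR_form_Hlinear f ->
  \tsum_(h1 ⊗ h2 <- comul h) twist f F (act R h1 r) (act R h2 s) =
  twist f (fun a b => \tsum_(h1 ⊗ h2 <- comul h) F (act R h1 a) (act R h2 b)) r s.
Proof.
move=> /linear_form lf bF hf; rewrite /twist.
have inv (g : H) (a b : R) (v : X) :
    \tsum_(h1 ⊗ h2 <- comul g) (f (act R h1 a ⊗ act R h2 b) *: v) =
    counit g *: (f (a ⊗ b) *: v).
  by rewrite scalerA -hf /diag_act; symmetry; lpush.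
lpush; rpush; lcomb.
lat ltac:(rewrite -actM; reflexivity).
lsink; lyd; lpush; symmetry.
transitivity (\tsum_(r1 ⊗ r2 <- bcomul R r) \tsum_(s1 ⊗ s2 <- bcomul R s)
  \tsum_(m ⊗ r20 <- coact R r2) \tsum_(a ⊗ c <- comul h) \tsum_(a1 ⊗ a2 <- comul a)
   (f (act R a1 r1 ⊗ act R a2 (act R m s1)) *:
     \tsum_(c1 ⊗ c2 <- comul c) F (act R c1 r20) (act R c2 s2))).
  apply: eq_tlift => r1 r2; apply: eq_tlift => s1 s2; apply: eq_tlift => m r20.
  by symmetry; lat ltac:(rewrite inv; reflexivity); lcu; lpush.
by lpush; lcomb; rcomb; sw_strip.
Qed.

End Twist.

Section TwistComp.
Variables (k : fieldType) (H : hopfAlg k) (R : ydHopfAlg H) (X : lmodType k).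

(** Convolution over R ⊗ R is associative, by colinearity of Δ_R, so f * (g * F) = (f * g) * F, and
    f * g is the counit by hypothesis. *)
Lemma twist_comp (f g : (R ⊗ R)%type -> k) (F : R -> R -> X) r s :
  scalar f -> scalar g -> bilin F ->
  (forall a b, @twist k H R k^o f (fun a b => g (a ⊗ b)) a b =
     bcounit R a * bcounit R b) ->
  twist f (twist g F) r s = F r s.
Proof.
move=> /linear_form lf /linear_form lg bF hfg.
transitivity (\tsum_(r1 ⊗ r2 <- bcomul R r) \tsum_(s1 ⊗ s2 <- bcomul R s)
  \tsum_(m ⊗ r20 <- coact R r2)
   (@twist k H R k^o f (fun a b => g (a ⊗ b)) r1 (act R m s1) *: F r20 s2)).
  rewrite /twist; lpush; rpush; lcb; lpush; lcomb; rcomb; sw_strip.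
  by rewrite scalerA.
lat ltac:(rewrite hfg; reflexivity).
by lpush; lcu.
Qed.

End TwistComp.

Section SelfComodule.
Variables (k : fieldType) (H : hopfAlg k) (R : ydHopfAlg H).

Lemma bcomul_coinv (e : R) : bcomul R e = e ⊗ 1 <-> exists c : k, e = c *: 1.
Proof.
split=> [h|[c ->]].
  exists (bcounit R e).
  have := congr1 (tlift (fun a b => bcounit R a *: b)) h.
  have bb : bilin (fun a b : R => bcounit R a *: b) by sbilin.
  by rewrite tliftE // (bcounitl (F := id)).
rewrite (linZ (@bcomul_lin _ _ R)) bcomul1.
by rewrite (linZ (g := fun z => z ⊗ 1)) //; slin.
Qed.

Lemma bcomul_comodule : is_right_comodule (bcomul R) (bcounit R) (bcomul R).
Proof.
split; first exact: bcomul_lin.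
  by move=> v; apply: bcoassoc; strilin.
by move=> v; apply: (bcounitr (F := id)).
Qed.

End SelfComodule.

Section RRform.
Variables (k : fieldType) (H : hopfAlg k) (R : ydHopfAlg H).
Implicit Types (f g : (R ⊗ R)%type -> k).

Lemma RR_convE f g t : scalar f -> scalar g ->
  \tsum_(u ⊗ v <- RR_comul t) (f u * g v) =
  \tsum_(a ⊗ b <- t) @twist k H R k^o f (fun a b => g (a ⊗ b)) a b.
Proof.
move=> /linear_form lf /linear_form lg.
change (@tlift k _ _ k^o (fun u v => f u *: (g v : k^o)) (RR_comul t) =
  \tsum_(a ⊗ b <- t) @twist k H R k^o f (fun a b => g (a ⊗ b)) a b).
by rewrite /RR_comul /twist; lpush.
Qed.

Lemma RR_conv f g a b : scalar f -> scalar g ->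
  \tsum_(u ⊗ v <- RR_comul (a ⊗ b)) (f u * g v) =
  @twist k H R k^o f (fun a b => g (a ⊗ b)) a b.
Proof.
move=> sf sg; rewrite RR_convE // tliftE //.
move: sf sg => /linear_form lf /linear_form lg.
by apply: twist_bilin => //; sbilin.
Qed.

Lemma RR_counitE (a b : R) : RR_counit (a ⊗ b) = bcounit R a * bcounit R b.
Proof.
change (@tlift k R R k^o (fun u v => bcounit R u *: (bcounit R v : k^o)) (a ⊗ b) =
  bcounit R a * bcounit R b).
by lpush.
Qed.

End RRform.

Section TwistR.
Variables (k : fieldType) (H : hopfAlg k) (R : ydHopfAlg H).
Variables (pi tau : (R ⊗ R)%type -> k).
Hypothesis (spi : scalar pi) (hpi : RR_form_Hlinear pi).
Hypothesis (stau : scalar tau) (htau : RR_form_Hlinear tau).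
Hypothesis pitau : is_conv_inverse_form (@RR_comul k H R) (@RR_counit k H R) pi tau.
Hypothesis pi11 : pi (1 ⊗ 1) = 1.
Hypothesis pi_cocycle : forall r s t : R,
        \tsum_(r1 ⊗ r2 <- bcomul R r) \tsum_(s1 ⊗ s2 <- bcomul R s)
        \tsum_(m ⊗ r20 <- coact R r2)
          (pi (r1 ⊗ act R m s1) * pi ((r20 * s2) ⊗ t))
      = \tsum_(s1 ⊗ s2 <- bcomul R s) \tsum_(t1 ⊗ t2 <- bcomul R t)
        \tsum_(m ⊗ s20 <- coact R s2)
          (pi (s1 ⊗ act R m t1) * pi (r ⊗ (s20 * t2))).

Let lpi : linear (pi : _ -> k^o). Proof. exact: spi. Qed.
Let ltau : linear (tau : _ -> k^o). Proof. exact: stau. Qed.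
#[local] Hint Resolve lpi ltau : sweedler.

Definition mulpi : R -> R -> R := twist pi *%R.

Lemma mulpi_bilin : bilin mulpi.
Proof. by apply: twist_bilin => //; exact: mul_bilin. Qed.
#[local] Hint Resolve mulpi_bilin : sweedler.

Lemma mulpi_cocycle r s t : pi (mulpi r s ⊗ t) = pi (r ⊗ mulpi s t).
Proof.
have := pi_cocycle r s t.
rewrite /mulpi /twist => h; symmetry; refine (eq_trans _ (eq_trans (esym h) _)).
  refine (_ : _ = _ :> k^o); lpush; reflexivity.
refine (_ : _ = _ :> k^o); symmetry; lpush; reflexivity.
Qed.

Lemma pi_tau a b : @twist k H R k^o pi (fun a b => tau (a ⊗ b)) a b =
  bcounit R a * bcounit R b.
Proof. by rewrite -RR_conv // (pitau _).1 RR_counitE. Qed.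

Lemma tau_pi a b : @twist k H R k^o tau (fun a b => pi (a ⊗ b)) a b =
  bcounit R a * bcounit R b.
Proof. by rewrite -RR_conv // (pitau _).2 RR_counitE. Qed.

Lemma mulpi_act h r s : act R h (mulpi r s) =
  \tsum_(h1 ⊗ h2 <- comul h) mulpi (act R h1 r) (act R h2 s).
Proof.
rewrite /mulpi twist_act //; last exact: mul_bilin.
by rewrite /twist; lpush; rpush; sw_strip.
Qed.

Lemma mulpi_bcomul r s : bcomul R (mulpi r s) =
  \tsum_(r1 ⊗ r2 <- bcomul R r) \tsum_(s1 ⊗ s2 <- bcomul R s)
    \tsum_(m ⊗ r20 <- coact R r2) (mulpi r1 (act R m s1) ⊗ (r20 * s2)).
Proof.
by rewrite /mulpi /twist; lpush; rpush; lcomb; rcomb; lcb; lpush; lcomb; sw_strip.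
Qed.

Ltac sw_local T ::=
  first
  [ lazymatch T with context [act R _ (mulpi _ _)] => rewrite mulpi_act end
  | lazymatch T with context [bcomul R (mulpi _ _)] => rewrite mulpi_bcomul end ].

Lemma mulpi11 : mulpi 1 1 = 1.
Proof. by rewrite /mulpi /twist; lpush; rewrite pi11 scale1r. Qed.

(** As 1 ·_π 1 = 1, the cocycle condition gives π(1, t) = π(1, 1 ·_π t) = π(1, t_(1)) π(1, t_(2)), a
    convolution idempotent. *)
Lemma pi1l t : pi (1 ⊗ t) = bcounit R t.
Proof.
apply: (idempotent_form (yd_coalgebra R) (f := fun t => pi (1 ⊗ t))
  (g := fun t => tau (1 ⊗ t))).
- refine (_ : linear ((fun t => pi (1 ⊗ t)) : R -> k^o)); slin.
- refine (_ : linear ((fun t => tau (1 ⊗ t)) : R -> k^o)); slin.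
- move=> {}t; rewrite -{1}mulpi11 mulpi_cocycle /mulpi /twist.
  by refine (_ : _ = _ :> k^o); lpush; lcu.
- move=> {}t; have := pi_tau 1 t; rewrite bcounit1 mul1r => <-; rewrite /twist.
  by refine (_ : _ = _ :> k^o); symmetry; lpush; lcu.
Qed.

Lemma pi1r t : pi (t ⊗ 1) = bcounit R t.
Proof.
apply: (idempotent_form (yd_coalgebra R) (f := fun t => pi (t ⊗ 1))
  (g := fun t => tau (t ⊗ 1))).
- refine (_ : linear ((fun t => pi (t ⊗ 1)) : R -> k^o)); slin.
- refine (_ : linear ((fun t => tau (t ⊗ 1)) : R -> k^o)); slin.
- move=> {}t; rewrite -{1}mulpi11 -mulpi_cocycle /mulpi /twist.
  by refine (_ : _ = _ :> k^o); lpush; lcu.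
- move=> {}t; have := pi_tau t 1; rewrite bcounit1 mulr1 => <-; rewrite /twist.
  by refine (_ : _ = _ :> k^o); symmetry; lpush; lcu.
Qed.

Lemma tau1l t : tau (1 ⊗ t) = bcounit R t.
Proof.
have := pi_tau 1 t; rewrite bcounit1 mul1r => <-; rewrite /twist.
refine (_ : _ = _ :> k^o); symmetry; lpush; lcu.
by lat ltac:(rewrite pi1l; reflexivity); lcu.
Qed.

Lemma mulpi1l r : mulpi 1 r = r.
Proof.
by rewrite /mulpi /twist; lpush; lat ltac:(rewrite pi1l; reflexivity); lcu.
Qed.

Lemma mulpi1r r : mulpi r 1 = r.
Proof.
rewrite /mulpi /twist; lpush; lcu.
by lat ltac:(rewrite pi1r; reflexivity); lcu.
Qed.

(** Once Δ of the inner product is expanded, both sides are ordinary triple products weighted by π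
    of a ·_π product, and the weights agree by [mulpi_cocycle]. *)
Lemma mulpiA : associative mulpi.
Proof.
move=> r s t.
transitivity (\tsum_(r1 ⊗ r2 <- bcomul R r) \tsum_(s1 ⊗ s2 <- bcomul R (mulpi s t))
  \tsum_(m ⊗ r20 <- coact R r2) (pi (r1 ⊗ act R m s1) *: (r20 * s2))).
  by [].
transitivity (\tsum_(r1 ⊗ r2 <- bcomul R (mulpi r s)) \tsum_(s1 ⊗ s2 <- bcomul R t)
  \tsum_(m ⊗ r20 <- coact R r2) (pi (r1 ⊗ act R m s1) *: (r20 * s2))); last by [].
lpush; rpush; lcomb; rcomb; sw_strip.
by rewrite mulpi_cocycle.
Qed.

(* The convolution inverse [inv_id] of the identity of k #_π R.  The map
   T(a ⊗ b) = a ·_π b_(1) ⊗ b_(2) is T_0 P, with T_0 the same map for π = ε and P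
   the convolution by π; [theta] is (id ⊗ ε) P^{-1} and gives a left inverse.  That it
   is a right inverse follows from injectivity of P ([id_mul_inv_twist]), so no
   anticomultiplicativity of the antipode is needed. *)
Definition theta (a b : R) : R := twist tau (fun a b => bcounit R b *: a) a b.
Definition inv_id (r : R) : R := \tsum_(r1 ⊗ r2 <- bcomul R r) theta (bantipode R r1) r2.

Lemma theta_bilin : bilin theta.
Proof. by apply: twist_bilin => //; sbilin. Qed.
#[local] Hint Resolve theta_bilin : sweedler.
Lemma inv_id_lin : linear inv_id.
Proof. by rewrite /inv_id; slin. Qed.
#[local] Hint Resolve inv_id_lin : sweedler.

Lemma inv_id_act h r : inv_id (act R h r) = act R h (inv_id r).
Proof.
have theta_act g a b : \tsum_(g1 ⊗ g2 <- comul g) theta (act R g1 a) (act R g2 b) =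
    act R g (theta a b).
  rewrite /theta twist_act //; last by sbilin.
  by rewrite /twist; lpush; lcu; rpush; rcu; sw_strip.
rewrite /inv_id; rpush; lpush.
lat ltac:(rewrite bantipode_act; reflexivity).
by symmetry; lat ltac:(rewrite -theta_act; reflexivity); sw_strip.
Qed.

(** With τ supplied by [theta] and π by ·_π, the left side is τ * (π * m) for m the multiplication
    of R. *)
Lemma mul_theta a b : \tsum_(b1 ⊗ b2 <- bcomul R b) mulpi (theta a b1) b2 = a * b.
Proof.
rewrite -(twist_comp (F := *%R) a b stau spi _ tau_pi); last exact: mul_bilin.
by rewrite -/mulpi /theta /twist; lpush; lcomb; rcomb; lcu; sw_strip.
Qed.

Lemma inv_id_invl r : \tsum_(r1 ⊗ r2 <- bcomul R r)
  mulpi (inv_id r1) r2 = bcounit R r *: 1.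
Proof.
rewrite /inv_id; lpush; lcomb.
lat ltac:(rewrite mul_theta; reflexivity).
by rewrite (bantil (F := id)).
Qed.

Definition id_mul_inv (r : R) : R := \tsum_(r1 ⊗ r2 <- bcomul R r) mulpi r1 (inv_id r2).

Lemma id_mul_inv_lin : linear id_mul_inv.
Proof. by rewrite /id_mul_inv; slin. Qed.
#[local] Hint Resolve id_mul_inv_lin : sweedler.

Lemma id_mul_inv_mul r : \tsum_(r1 ⊗ r2 <- bcomul R r) mulpi (id_mul_inv r1) r2 = r.
Proof.
rewrite /id_mul_inv; lpush; lcomb.
transitivity (\tsum_(r1 ⊗ r2 <- bcomul R r) (bcounit R r2 *: r1)); last first.
  by rewrite (bcounitr (F := id)).
apply: eq_tlift => a b; lat ltac:(rewrite -mulpiA; reflexivity).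
rewrite -(tlift_lin (g := mulpi a)); last by slin.
by rewrite inv_id_invl (linZ (g := mulpi a)) ?mulpi1r //; slin.
Qed.

Lemma bantir3 (X : lmodType k) (F : R -> R -> X) b : bilin F ->
  \tsum_(b1 ⊗ b' <- bcomul R b) \tsum_(b2 ⊗ b3 <- bcomul R b')
    F (b1 * bantipode R b2) b3 = F 1 b.
Proof.
move=> bF; rewrite -(bcoassoc (F := fun b1 b2 b3 => F (b1 * bantipode R b2) b3));
  last by strilin.
transitivity (\tsum_(a ⊗ c <- bcomul R b) (bcounit R a *: F 1 c)); last by lcu.
by apply: eq_tlift => a c; rewrite (bantir (F := fun z => F z c)) //; slin.
Qed.

(** Write q for [id_mul_inv] and start from r_(1) S(r_(2)) ⊗ r_(3) = 1 ⊗ r. Replacing r_(1) by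
    q(r_(1)) ·_π r_(2) puts an ordinary product before S; the antipode cancels it and leaves
    P(q(r_(1)) ⊗ r_(2)). *)
Lemma id_mul_inv_twist r :
  \tsum_(r1 ⊗ r2 <- bcomul R r) twist pi tens (id_mul_inv r1) r2 = 1 ⊗ r.
Proof.
rewrite -(bantir3 (F := tens)); last exact: tens_bilin.
rewrite -(bcoassoc (F := fun b1 b2 b3 => (b1 * bantipode R b2) ⊗ b3)); last by strilin.
symmetry.
transitivity (\tsum_(x ⊗ y <- bcomul R r) \tsum_(a ⊗ b <- bcomul R x)
    (\tsum_(c ⊗ d <- bcomul R a) mulpi (id_mul_inv c) d) * bantipode R b ⊗ y).
  by apply: eq_tlift => x y; apply: eq_tlift => a b; rewrite id_mul_inv_mul.
rewrite /mulpi /twist; lpush; lcomb; rpush; sw_strip.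
(* The argument z holds the product r_(i) S(r_(i+1)), which [bantir3] replaces by 1. *)
pose L (z t : R) := \tsum_(a1 ⊗ a2 <- bcomul R (id_mul_inv v))
   \tsum_(m ⊗ a20 <- coact R a2) (pi (a1 ⊗ act R m v0) *: ((a20 * z) ⊗ t)).
transitivity (L 1 w0); last by rewrite /L; lpush.
rewrite -(bantir3 (F := L)) /L; last by sbilin.
by rpush; sw_strip.
Qed.

Lemma inv_id_invr r : id_mul_inv r = bcounit R r *: 1.
Proof.
have bt : bilin (twist tau (@tens k R R)).
  by apply: twist_bilin => //; exact: tens_bilin.
(* Convolution by τ undoes P, and it fixes 1 ⊗ r because τ(1, t) = ε(t). *)
have h : \tsum_(r1 ⊗ r2 <- bcomul R r) (id_mul_inv r1 ⊗ r2) = 1 ⊗ r.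
  transitivity (tlift (twist tau (@tens k R R)) (1 ⊗ r)); last first.
    rewrite tliftE // /twist; lpush; lat ltac:(rewrite tau1l; reflexivity).
    by lcu.
  rewrite -id_mul_inv_twist tlift_lin; last exact: tlift_linear.
  apply: eq_tlift => r1 r2.
  rewrite -[LHS](twist_comp _ _ spi stau (@tens_bilin k R R) pi_tau).
  by rewrite {1}/twist [twist pi tens _ _]/twist; rpush.
have := congr1 (tlift (fun a b => bcounit R b *: a)) h.
have bb : bilin (fun a b : R => bcounit R b *: a) by sbilin.
by rewrite tliftE // => <-; symmetry; lpush; lcu.
Qed.

Lemma twistR_cleft : is_cleftR (twistR pi).
Proof.
have a0 := @act_bilin k H R.
split; split=> /=.
- split; [exact: mulpi_bilin|exact: mulpiA|exact: mulpi1l|exact: mulpi1r|].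
  exact: oner_neq0.
- by split; [exact: act_bilin|exact: act1|exact: actM].
- exact: mulpi_act.
- exact: act_one.
- exact: bcomul_comodule.
- exact: bcomul_act.
- exact: mulpi_bcomul.
- exact: bcomul1.
- exact: bcomul_coinv.
- by [].
- by [].
- by move=> r; symmetry; apply: tlift_id.
- exists inv_id; split; [exact: inv_id_lin|exact: inv_id_act|].
  by move=> c; split; [exact: inv_id_invr|exact: inv_id_invl].
- by [].
Qed.

End TwistR.

Lemma ZR_twistR_cleft (k : fieldType) (H : hopfAlg k) (R : ydHopfAlg H) pi :
  @ZR k H R pi -> is_cleftR (twistR pi).
Proof. by case=> spi hpi [tau [stau htau h]] h1 h2; apply: twistR_cleft h h1 h2. Qed.

Ltac sw_local T ::= fail.

(** * The bialgebra R # H *)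

Section BosonBialgebra.
Variables (k : fieldType) (H : hopfAlg k) (R : ydHopfAlg H).

(* The bialgebra axioms of R # H are the case E = R of those of E # H. *)
Definition selfR : cleftR R := @CleftR k H R R *%R 1 (act R) (bcomul R) id.

Lemma selfR_module_algebra : is_module_algebra selfR.
Proof.
split=> /=.
- split; [exact: mul_bilin|exact: mulrA|exact: mul1r|exact: mulr1|exact: oner_neq0].
- by split; [exact: act_bilin|exact: act1|exact: actM].
- exact: act_mul.
- exact: act_one.
Qed.

Lemma selfR_comodule_algebra : is_comodule_algebra_R selfR.
Proof.
split=> /=.
- exact: bcomul_comodule.
- exact: bcomul_act.
- exact: bcomulM.
- exact: bcomul1.
- exact: bcomul_coinv.
Qed.

Lemma boson_bialgebra : is_bialgebra (boson R).
Proof.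
have [hA [lD DA De] DM D1 _] := smash_comodule_algebra selfR_module_algebra
  selfR_comodule_algebra.
split=> //.
- split=> //.
  + refine (_ : linear ((@b_counit k (boson R)) : (R ⊗ H)%type -> k^o)).
    by rewrite /b_counit /=; slin.
  + move=> x; rewrite /b_counit /b_comul /= /smash_coact; lpush; lcu.
    exact: tlift_id.
split=> [x y|].
  change (b_counit (b_mul x y) = b_counit x *: (b_counit y : k^o) :> k^o).
  change (@tlift k R H k^o (fun r h => bcounit R r * counit h)
    (smash_mul *%R (act R) x y) =
    @tlift k R H k^o (fun r h => bcounit R r * counit h) x *:
    @tlift k R H k^o (fun r h => bcounit R r * counit h) y).
  rewrite /smash_mul; lpush; rpush.
  apply: eq_tlift => r h; apply: eq_tlift => r' h'.
  transitivity (\tsum_(h1 ⊗ h2 <- comul h) (counit h1 *: (counit h2 *: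
      (bcounit R r *: (bcounit R r' *: (counit h' : k^o)))))).
    by apply: eq_tlift => h1 h2; rewrite /GRing.scale /=; ring.
  by lcu; rewrite /GRing.scale /=; ring.
change (@tlift k R H k^o (fun r h => bcounit R r * counit h) (1 ⊗ 1) = 1).
by lpush.
Qed.

End BosonBialgebra.

(** * From Z'(R # H) to Z(R) *)

Section Conv3.
Variables (k : fieldType) (H : hopfAlg k) (B : bialgData k) (j : H -> B).
Variables (sigma tau : (B ⊗ B)%type -> k).
Hypothesis hB : is_bialgebra B.
Hypothesis lj : linear j.
Hypothesis Dj : forall h, b_comul (j h) = \tsum_(h1 ⊗ h2 <- comul h) (j h1 ⊗ j h2).
Hypothesis ej : forall h, b_counit (j h) = counit h.
Hypothesis ss : scalar sigma.
Hypothesis st : scalar tau.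
Hypothesis hst : is_conv_inverse_form (@BB_comul k B) (@BB_counit k B) sigma tau.
Local Notation D := (@b_comul k B).
Local Notation e := (@b_counit k B).
Local Notation mulB := (@b_mul k B).
Local Notation oneB := (@b_one k B).
Let ls : linear (sigma : _ -> k^o). Proof. exact: ss. Qed.
Let lt : linear (tau : _ -> k^o). Proof. exact: st. Qed.
Let hD : is_coalgebra D e. Proof. by case: hB. Qed.
Let lD : linear D. Proof. exact: coalg_lin hD. Qed.
Let le : linear (e : B -> k^o). Proof. exact: coalg_linc hD. Qed.
Let bmB : bilin mulB. Proof. by case: hB => _ []. Qed.
Let DM x y : D (mulB x y) = \tsum_(x1 ⊗ x2 <- D x)
        \tsum_(y1 ⊗ y2 <- D y) (mulB x1 y1 ⊗ mulB x2 y2).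
Proof. by case: hB. Qed.
Let eM x y : e (mulB x y) = e x * e y. Proof. by case: hB => _ _ _ _ []. Qed.
#[local] Hint Resolve lD le bmB ls lt lj : sweedler.
Ltac sw_local T ::=
  first
  [ lazymatch T with context [D (mulB _ _)] => rewrite DM end
  | lazymatch T with context [D (j _)] => rewrite Dj end ].
Ltac sw_assoc_local ::= refine (coassoc hD _ _).
Ltac sw_counit_local ::= first [refine (counitl hD _ _) | refine (counitr hD _ _)].

Lemma BB_conv_pure (f g : (B ⊗ B)%type -> k) (x y : B) : scalar f -> scalar g ->
  is_conv_inverse_form (@BB_comul k B) (@BB_counit k B) f g ->
  \tsum_(x1 ⊗ x2 <- D x) \tsum_(y1 ⊗ y2 <- D y)
    (f (x1 ⊗ y1) *: (g (x2 ⊗ y2) : k^o)) = e x * e y.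
Proof.
move=> sf sg h; have [+ _] := h (x ⊗ y).
rewrite BB_convE //; move: (sf) (sg) => /linear_form lf /linear_form lg.
have b1 : bilin (fun x y => \tsum_(x1 ⊗ x2 <- D x) \tsum_(y1 ⊗ y2 <- D y)
    (f (x1 ⊗ y1) *: (g (x2 ⊗ y2) : k^o))) by sbilin.
have b2 : bilin (fun x y => (e x * e y : k^o)) by sbilin.
by rewrite tliftE // => ->; apply: (tliftE b2).
Qed.

(** Uniqueness of convolution inverses over the coalgebra H ⊗ B ⊗ B, curried to avoid a structure on
    the triple tensor product. *)
Lemma conv3_unique (s t1 t2 : H -> B -> B -> k^o) :
  trilin s -> trilin t1 -> trilin t2 ->
  (forall h x y, \tsum_(h1 ⊗ h2 <- comul h) \tsum_(x1 ⊗ x2 <- D x)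
     \tsum_(y1 ⊗ y2 <- D y) (s h1 x1 y1 *: t1 h2 x2 y2) = counit h * (e x * e y)) ->
  (forall h x y, \tsum_(h1 ⊗ h2 <- comul h) \tsum_(x1 ⊗ x2 <- D x)
     \tsum_(y1 ⊗ y2 <- D y) (t2 h1 x1 y1 *: s h2 x2 y2) = counit h * (e x * e y)) ->
  forall h x y, t1 h x y = t2 h x y.
Proof.
move=> [s1 s2 s3] [t11 t12 t13] [t21 t22 t23] h1 h2 h x y.
transitivity (\tsum_(h1 ⊗ h2 <- comul h) \tsum_(x1 ⊗ x2 <- D x)
  \tsum_(y1 ⊗ y2 <- D y) ((\tsum_(h3 ⊗ h4 <- comul h1) \tsum_(x3 ⊗ x4 <- D x1)
     \tsum_(y3 ⊗ y4 <- D y1) ((t2 h3 x3 y3 : k) * (s h4 x4 y4 : k))) *: t1 h2 x2 y2)).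
  transitivity (\tsum_(h1 ⊗ h2 <- comul h) \tsum_(x1 ⊗ x2 <- D x)
    \tsum_(y1 ⊗ y2 <- D y) (counit h1 *: (e x1 *: (e y1 *: t1 h2 x2 y2)))).
    by symmetry; lcu.
  apply: eq_tlift => h3 h4; apply: eq_tlift => x3 x4; apply: eq_tlift => y3 y4.
  by rewrite !scalerA; congr (_ *: _); rewrite -mulrA -h2.
transitivity (\tsum_(h1 ⊗ h2 <- comul h) \tsum_(x1 ⊗ x2 <- D x)
  \tsum_(y1 ⊗ y2 <- D y) (t2 h1 x1 y1 *:
     (\tsum_(h3 ⊗ h4 <- comul h2) \tsum_(x3 ⊗ x4 <- D x2)
     \tsum_(y3 ⊗ y4 <- D y2) (s h3 x3 y3 *: t1 h4 x4 y4)))); last first.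
  transitivity (\tsum_(h1 ⊗ h2 <- comul h) \tsum_(x1 ⊗ x2 <- D x)
    \tsum_(y1 ⊗ y2 <- D y) (counit h2 *: (e x2 *: (e y2 *: t2 h1 x1 y1)))); last by lcu.
  apply: eq_tlift => h3 h4; apply: eq_tlift => x3 x4; apply: eq_tlift => y3 y4.
  by rewrite h1 /GRing.scale /=; ring.
by lpush; rpush; lcomb; rcomb; sw_strip.
Qed.

(* Symmetries of σ pass to its convolution inverse τ, by uniqueness of inverses. *)
Lemma conv_form_transfer (f1 f2 : H -> B -> B -> (B ⊗ B)%type) :
  trilin f1 -> trilin f2 ->
  (forall h x y, BB_comul (f1 h x y) = \tsum_(h1 ⊗ h2 <- comul h)
    \tsum_(x1 ⊗ x2 <- D x) \tsum_(y1 ⊗ y2 <- D y) (f1 h1 x1 y1 ⊗ f1 h2 x2 y2)) ->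
  (forall h x y, BB_comul (f2 h x y) = \tsum_(h1 ⊗ h2 <- comul h)
    \tsum_(x1 ⊗ x2 <- D x) \tsum_(y1 ⊗ y2 <- D y) (f2 h1 x1 y1 ⊗ f2 h2 x2 y2)) ->
  (forall h x y, BB_counit (f1 h x y) = counit h * (e x * e y)) ->
  (forall h x y, BB_counit (f2 h x y) = counit h * (e x * e y)) ->
  (forall h x y, sigma (f1 h x y) = sigma (f2 h x y)) ->
  forall h x y, tau (f1 h x y) = tau (f2 h x y).
Proof.
move=> [F1 F2 F3] [G1 G2 G3] D1 D2 e1 e2 h12.
apply: (@conv3_unique (fun h x y => sigma (f1 h x y)) (fun h x y => tau (f1 h x y))
  (fun h x y => tau (f2 h x y))); try strilin; move=> h x y.
- rewrite -e1 -(hst _).1 D1.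
  refine (_ : _ = @tlift k _ _ k^o (fun u v => sigma u *: (tau v : k^o)) _).
  by rpush.
- rewrite -e2 -(hst _).2 D2.
  refine (_ : _ = @tlift k _ _ k^o (fun u v => tau u *: (sigma v : k^o)) _).
  rpush; do 3 (apply: eq_tlift => ? ?); by rewrite h12.
Qed.

Lemma tau_middle h x y : (forall h x y,
   sigma (mulB x (j h) ⊗ y) = sigma (x ⊗ mulB (j h) y)) ->
   tau (mulB x (j h) ⊗ y) = tau (x ⊗ mulB (j h) y).
Proof.
move=> hs; apply: (@conv_form_transfer (fun h x y => mulB x (j h) ⊗ y)
  (fun h x y => x ⊗ mulB (j h) y)); try strilin; try exact: hs; move=> {}h {}x {}y.
- by rewrite /BB_comul; lpush; rpush; sw_strip.
- by rewrite /BB_comul; lpush; rpush; sw_strip.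
- rewrite /BB_counit (tliftE (U := k^o)) ?eM ?ej; last by sbilin.
  by ring.
- rewrite /BB_counit (tliftE (U := k^o)) ?eM ?ej; last by sbilin.
  by ring.
Qed.

Lemma tau_right h x y : (forall h x y,
   sigma (x ⊗ mulB y (j h)) = counit h * sigma (x ⊗ y)) ->
   tau (x ⊗ mulB y (j h)) = counit h * tau (x ⊗ y).
Proof.
move=> hs.
(* Moving ε(h) into the argument makes both sides values of τ at maps H ⊗ B ⊗ B → B ⊗ B compatible
   with coproducts. *)
have -> : counit h * tau (x ⊗ y) = tau (counit h *: (x ⊗ y)) by rewrite (linZ lt).
apply: (@conv_form_transfer (fun h x y => x ⊗ mulB y (j h))
  (fun h x y => counit h *: (x ⊗ y))); try strilin; move=> {}h {}x {}y.
- by rewrite /BB_comul; lpush; rpush; sw_strip.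
- by rewrite /BB_comul; lpush; rpush; rcu; lcu; sw_strip.
- rewrite /BB_counit (tliftE (U := k^o)) ?eM ?ej; last by sbilin.
  by ring.
- have b : bilin (fun x y => e x * e y : k^o) by sbilin.
  by rewrite /BB_counit (tliftZ b) (tliftE b).
- by rewrite hs (linZ ls).
Qed.

Lemma tau_left h x y : (forall h x y,
   sigma (mulB (j h) x ⊗ y) = counit h * sigma (x ⊗ y)) ->
   tau (mulB (j h) x ⊗ y) = counit h * tau (x ⊗ y).
Proof.
move=> hs.
have -> : counit h * tau (x ⊗ y) = tau (counit h *: (x ⊗ y)) by rewrite (linZ lt).
apply: (@conv_form_transfer (fun h x y => mulB (j h) x ⊗ y)
  (fun h x y => counit h *: (x ⊗ y))); try strilin; move=> {}h {}x {}y.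
- by rewrite /BB_comul; lpush; rpush; sw_strip.
- by rewrite /BB_comul; lpush; rpush; rcu; lcu; sw_strip.
- rewrite /BB_counit (tliftE (U := k^o)) ?eM ?ej; last by sbilin.
  by ring.
- have b : bilin (fun x y => e x * e y : k^o) by sbilin.
  by rewrite /BB_counit (tliftZ b) (tliftE b).
- by rewrite hs (linZ ls).
Qed.

Hypothesis s11 : sigma (oneB ⊗ oneB) = 1.
Hypothesis s_cocycle : forall x y z : B,
  \tsum_(x1 ⊗ x2 <- D x) \tsum_(y1 ⊗ y2 <- D y)
    (sigma (x1 ⊗ y1) * sigma (mulB x2 y2 ⊗ z))
  = \tsum_(y1 ⊗ y2 <- D y) \tsum_(z1 ⊗ z2 <- D z)
    (sigma (y1 ⊗ z1) * sigma (x ⊗ mulB y2 z2)).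

Let s_cocycle' (x y z : B) :
  \tsum_(x1 ⊗ x2 <- D x) \tsum_(y1 ⊗ y2 <- D y)
    (sigma (x1 ⊗ y1) *: (sigma (mulB x2 y2 ⊗ z) : k^o))
  = \tsum_(y1 ⊗ y2 <- D y) \tsum_(z1 ⊗ z2 <- D z)
    (sigma (y1 ⊗ z1) *: (sigma (x ⊗ mulB y2 z2) : k^o)).
Proof. exact: s_cocycle. Qed.
Let D1 : D oneB = oneB ⊗ oneB. Proof. by case: hB. Qed.
Let mul1B : left_id oneB mulB. Proof. by case: hB => _ []. Qed.
Let e1 : e oneB = 1. Proof. by case: hB => _ _ _ _ []. Qed.

Lemma cocycle_unitl y : sigma (oneB ⊗ y) = e y.
Proof.
apply: (idempotent_form hD (f := fun y => sigma (oneB ⊗ y))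
  (g := fun y => tau (oneB ⊗ y))).
- refine (_ : linear ((fun t => sigma (oneB ⊗ t)) : B -> k^o)); slin.
- refine (_ : linear ((fun t => tau (oneB ⊗ t)) : B -> k^o)); slin.
- move=> t; have := s_cocycle' oneB oneB t; rewrite D1.
  do 3 (rewrite tliftE; last by sbilin).
  rewrite !mul1B s11 scale1r => ->.
  by apply: eq_tlift => t1 t2; rewrite mul1B.
- move=> t; have := BB_conv_pure oneB t ss st hst; rewrite D1 e1 mul1r => <-.
  by rewrite tliftE //; sbilin.
Qed.

(** Writing j(h) = 1 · j(h) and moving j(h) across gives σ(j(h), z) = ε(h) ε(z). The cocycle
    identity at (j(h), x, y) then has σ(j(h) x, y) on its left and ε(h) σ(x, y) on its right. *)
Lemma cocycle_left h x y : (forall h x y,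
   sigma (mulB x (j h) ⊗ y) = sigma (x ⊗ mulB (j h) y)) ->
   sigma (mulB (j h) x ⊗ y) = counit h * sigma (x ⊗ y).
Proof.
move=> hm; have sj g z : sigma (j g ⊗ z) = counit g * e z.
  by rewrite -[j g]mul1B hm cocycle_unitl eM ej.
refine (_ : _ = _ :> k^o); refine (eq_trans _ (eq_trans (s_cocycle' (j h) x y) _)).
  by symmetry; lpush; lat ltac:(rewrite sj; reflexivity); lpush; lcu.
transitivity (\tsum_(y1 ⊗ y2 <- D x) \tsum_(z1 ⊗ z2 <- D y)
   (e y2 *: (e z2 *: (counit h *: (sigma (y1 ⊗ z1) : k^o))))); last by lcu.
apply: eq_tlift => y1 y2; apply: eq_tlift => z1 z2.
by rewrite sj eM /GRing.scale /=; ring.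
Qed.

End Conv3.

Ltac sw_local T ::= fail.
Ltac sw_assoc_local ::= fail.
Ltac sw_counit_local ::= fail.

Lemma lin_tens_ext (k : fieldType) (V W X : lmodType k) (f g : (V ⊗ W)%type -> X) :
  linear f -> linear g -> (forall v w, f (v ⊗ w) = g (v ⊗ w)) -> f =1 g.
Proof.
move=> lf lg h; apply: tens_ind => [|v w t IH]; first by rewrite !lin0.
by rewrite !linD // h IH.
Qed.

Lemma boson_form_ext (k : fieldType) (H : hopfAlg k) (R : ydHopfAlg H)
    (f g : (boson R ⊗ boson R)%type -> k) : scalar f -> scalar g ->
  (forall r h s h', f (((r ⊗ h) : boson R) ⊗ ((s ⊗ h') : boson R)) =
     g (((r ⊗ h) : boson R) ⊗ ((s ⊗ h') : boson R))) -> f =1 g.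
Proof.
move=> /linear_form lf /linear_form lg fg.
refine (@lin_tens_ext k (boson R) (boson R) k^o _ _ lf lg _) => x y.
move: x; refine (@lin_tens_ext k R H k^o (fun x : boson R => f (x ⊗ y))
  (fun x : boson R => g (x ⊗ y)) _ _ _); try slin.
move=> r h; move: y; refine (@lin_tens_ext k R H k^o
  (fun y : boson R => f ((r ⊗ h : boson R) ⊗ y))
  (fun y : boson R => g ((r ⊗ h : boson R) ⊗ y)) _ _ (fg r h)); slin.
Qed.

Section ZprimeForm.
Variables (k : fieldType) (H : hopfAlg k) (R : ydHopfAlg H).
Local Notation B := (boson R).
Variable sigma : (B ⊗ B)%type -> k.
Hypothesis hs : Z'boson sigma.

Let ss : scalar sigma. Proof. by case: hs => -[]. Qed.
Let ls : linear (sigma : _ -> k^o). Proof. exact: ss. Qed.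
#[local] Hint Resolve ls : sweedler.

Definition restrict (f : (B ⊗ B)%type -> k) (t : (R ⊗ R)%type) : k :=
  \tsum_(r ⊗ s <- t) f (((r ⊗ 1) : B) ⊗ ((s ⊗ 1) : B)).

Lemma restrict_bilin (f : (B ⊗ B)%type -> k) : scalar f ->
  bilin (fun r s : R => f (((r ⊗ 1) : B) ⊗ ((s ⊗ 1) : B)) : k^o).
Proof. by move=> /linear_form lf; sbilin. Qed.

Lemma restrict_scalar f : scalar f -> scalar (restrict f).
Proof. by move=> /restrict_bilin bf; apply: (tlift_linear bf). Qed.

Lemma restrictE f r s : scalar f ->
  restrict f (r ⊗ s) = f (((r ⊗ 1) : B) ⊗ ((s ⊗ 1) : B)).
Proof. by move=> /restrict_bilin bf; apply: (tliftE bf). Qed.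

Local Notation pi := (restrict sigma).

Lemma sigmaE r h s h' : sigma (((r ⊗ h) : B) ⊗ ((s ⊗ h') : B)) =
  pi (r ⊗ act R h s) * counit h'.
Proof. by rewrite (proj2 hs) restrictE. Qed.

Definition inH (h : H) : B := 1 ⊗ h.

Lemma inH_lin : linear inH.
Proof. by rewrite /inH; slin. Qed.

Lemma inH_comul h : b_comul (inH h) = \tsum_(h1 ⊗ h2 <- comul h) (inH h1 ⊗ inH h2).
Proof. by rewrite /inH /b_comul /= /smash_coact; lpush. Qed.

Lemma inH_counit h : b_counit (inH h) = counit h.
Proof.
change (@tlift k R H k^o (fun r h => bcounit R r * counit h) (1 ⊗ h) = counit h).
by lpush.
Qed.

Lemma mul_inHr (r : R) (g h : H) : b_mul ((r ⊗ g) : B) (inH h) = r ⊗ (g * h).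
Proof. by rewrite /inH /b_mul /= /smash_mul; lpush; lcu. Qed.

Lemma mul_inHl (r : R) (g h : H) : b_mul (inH h) ((r ⊗ g) : B) =
  \tsum_(h1 ⊗ h2 <- comul h) (act R h1 r ⊗ (h2 * g)).
Proof. by rewrite /inH /b_mul /= /smash_mul; lpush. Qed.

(** With [sigma_right], the Z' formula recast as rules for multiplication by elements of H; in this
    form it can be transferred to the convolution inverse. *)
Lemma sigma_middle h (x y : B) :
  sigma (b_mul x (inH h) ⊗ y) = sigma (x ⊗ b_mul (inH h) y).
Proof.
have bB : bilin (@b_mul k B) by case: (boson_bialgebra R) => _ [].
move: x; refine (@lin_tens_ext k R H k^o (fun x : B => sigma (b_mul x (inH h) ⊗ y))
  (fun x : B => sigma (x ⊗ b_mul (inH h) y)) _ _ _); try slin; move=> r g.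
move: y; refine (@lin_tens_ext k R H k^o
  (fun y : B => sigma (b_mul (r ⊗ g : B) (inH h) ⊗ y))
  (fun y : B => sigma ((r ⊗ g : B) ⊗ b_mul (inH h) y)) _ _ _); try slin; move=> s h'.
rewrite mul_inHr mul_inHl sigmaE; refine (_ : _ = _ :> k^o); symmetry; lpush.
lat ltac:(rewrite sigmaE; reflexivity).
have lp : linear (pi : _ -> k^o) := linear_form (restrict_scalar ss).
transitivity (\tsum_(h1 ⊗ h2 <- comul h)
   (counit h2 *: (counit h' *: (pi (r ⊗ act R g (act R h1 s)) : k^o)))).
  by apply: eq_tlift => h1 h2; rewrite counitM /GRing.scale /=; ring.
by lcu; rewrite actM [RHS]mulrC.
Qed.

Lemma sigma_right h (x y : B) :
  sigma (x ⊗ b_mul y (inH h)) = counit h * sigma (x ⊗ y).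
Proof.
have bB : bilin (@b_mul k B) by case: (boson_bialgebra R) => _ [].
move: x; refine (@lin_tens_ext k R H k^o (fun x : B => sigma (x ⊗ b_mul y (inH h)))
  (fun x : B => counit h *: (sigma (x ⊗ y) : k^o)) _ _ _); try slin; move=> r g.
move: y; refine (@lin_tens_ext k R H k^o
  (fun y : B => sigma ((r ⊗ g : B) ⊗ b_mul y (inH h)))
  (fun y : B => counit h *: (sigma ((r ⊗ g : B) ⊗ y) : k^o)) _ _ _); try slin.
move=> s h'.
by rewrite mul_inHr !sigmaE counitM /GRing.scale /=; ring.
Qed.

Section Restrict.
Variable f : (B ⊗ B)%type -> k.
Hypothesis sf : scalar f.
Hypothesis fE : forall r h s h', f (((r ⊗ h) : B) ⊗ ((s ⊗ h') : B)) =
  restrict f (r ⊗ act R h s) * counit h'.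

(** In (1 ⊗ h)(r ⊗ 1) = h_(1) · r ⊗ h_(2), the formula for f makes h_(2) act on s, so left
    invariance of f becomes invariance under the diagonal action. *)
Lemma restrict_Hlinear :
  (forall h x y, f (b_mul (inH h) x ⊗ y) = counit h * f (x ⊗ y)) ->
  RR_form_Hlinear (restrict f).
Proof.
move=> left h.
have lf := linear_form (restrict_scalar sf); have lf0 := linear_form sf.
refine (@lin_tens_ext k R R k^o (fun t => restrict f (diag_act (act R) (act R) h t))
  (fun t => counit h *: (restrict f t : k^o)) _ _ _); first by rewrite /diag_act; slin.
  by slin.
move=> r s; rewrite /diag_act; lpush.
refine (eq_trans _ (eq_trans (left h (r ⊗ 1) (s ⊗ 1)) _)).
  rewrite mul_inHl; symmetry; refine (_ : _ = _ :> k^o); lpush; apply: eq_tlift => h1 h2.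
  by rewrite fE counit1 mulr1.
by rewrite fE act1 counit1 mulr1.
Qed.

Variable g : (B ⊗ B)%type -> k.
Hypothesis sg : scalar g.
Hypothesis gE : forall r h s h', g (((r ⊗ h) : B) ⊗ ((s ⊗ h') : B)) =
  restrict g (r ⊗ act R h s) * counit h'.

(** The first factor of Δ(a ⊗ 1) carries a_(2)(-1) in H; the formula for f makes it act on b_(1),
    which is the braiding in the coproduct of R ⊗ R. *)
Lemma restrict_conv a b : is_conv_inverse_form (@BB_comul k B) (@BB_counit k B) f g ->
  @twist k H R k^o (restrict f) (fun a b => restrict g (a ⊗ b)) a b =
  bcounit R a * bcounit R b.
Proof.
move=> fg.
have lf := linear_form (restrict_scalar sf); have lf0 := linear_form sf.
have lg := linear_form (restrict_scalar sg); have lg0 := linear_form sg.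
have ce (c : R) : b_counit ((c ⊗ 1) : B) = bcounit R c.
  change (@tlift k R H k^o (fun r h => bcounit R r * counit h) (c ⊗ 1) = bcounit R c).
  by lpush; rewrite ?mulr1.
have := BB_conv_pure (boson_bialgebra R) ((a ⊗ 1) : B) ((b ⊗ 1) : B) sf sg fg.
rewrite !ce => <-; rewrite /b_comul /= /smash_coact; symmetry; lpush.
lat ltac:(rewrite fE gE act1 counit1 mulr1; reflexivity); lpush; lcu.
by rewrite /twist; sw_strip.
Qed.

End Restrict.

Lemma restrict_ZR : ZR pi.
Proof.
have [[_ [tau st hst] s11 scoc] _] := hs.
have hB := boson_bialgebra R.
have lt := linear_form st.
have mid := tau_middle hB inH_lin inH_comul inH_counit ss st hst _ _ _ sigma_middle.
have right := tau_right hB inH_lin inH_comul inH_counit ss st hst _ _ _ sigma_right.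
have sleft h x y := cocycle_left hB inH_lin inH_comul inH_counit ss st hst s11 scoc
  h x y sigma_middle.
have left := tau_left hB inH_lin inH_comul inH_counit ss st hst _ _ _ sleft.
(* Since r ⊗ h = (r ⊗ 1)(1 ⊗ h), the right and middle rules for τ rebuild the Z' formula. *)
have tauE r h s h' : tau (((r ⊗ h) : B) ⊗ ((s ⊗ h') : B)) =
    restrict tau (r ⊗ act R h s) * counit h'.
  rewrite restrictE //.
  transitivity (tau (b_mul ((r ⊗ 1) : B) (inH h) ⊗ b_mul ((s ⊗ 1) : B) (inH h'))).
    by rewrite !mul_inHr !mul1r.
  rewrite right mid mul_inHl; symmetry; rewrite mulrC; congr (_ * _).
  refine (_ : _ = _ :> k^o); symmetry; lpush.
  transitivity (\tsum_(h1 ⊗ h2 <- comul h)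
    (counit h2 *: (tau (((r ⊗ 1) : B) ⊗ ((act R h1 s ⊗ 1) : B)) : k^o)));
    last by lcu.
  apply: eq_tlift => h1 h2; rewrite -[_ *: _]right mul_inHr ?mul1r ?mulr1 //.
split.
- exact: restrict_scalar.
- exact: (restrict_Hlinear ss sigmaE sleft).
- exists (restrict tau); split; first exact: restrict_scalar.
    exact: (restrict_Hlinear st tauE left).
  have aux f g : scalar f -> scalar g ->
      (forall a b, @twist k H R k^o f (fun a b => g (a ⊗ b)) a b =
        bcounit R a * bcounit R b) ->
      forall t, \tsum_(u ⊗ v <- RR_comul t) (f u * g v) = RR_counit t.
    move=> sf sg h t; rewrite RR_convE // /RR_counit.
    by apply: eq_tlift => a b; rewrite h.
  move=> t; split; apply: aux; try exact: restrict_scalar; move=> a b.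
    exact: (restrict_conv ss sigmaE st tauE).
  apply: (restrict_conv st tauE ss sigmaE) => u.
  by case: (hst u).
- by rewrite restrictE.
- move=> r s t.
  have lp : linear (pi : _ -> k^o) := linear_form (restrict_scalar ss).
  (* On R ⊗ 1 the σ-weighted product of R # H is the π-weighted product of R. Taking for [G] the
     form σ with its other argument fixed covers both sides of the cocycle identity. *)
  have aux (G : (R ⊗ H)%type -> k^o) (a b : R) : linear G ->
      \tsum_(x1 ⊗ x2 <- smash_coact (bcomul R) (a ⊗ 1))
      \tsum_(y1 ⊗ y2 <- smash_coact (bcomul R) (b ⊗ 1))
        (sigma (x1 ⊗ y1) *: G (smash_mul *%R (act R) x2 y2)) =
      \tsum_(a1 ⊗ a2 <- bcomul R a) \tsum_(b1 ⊗ b2 <- bcomul R b)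
        \tsum_(m ⊗ a20 <- coact R a2) (pi (a1 ⊗ act R m b1) *: G ((a20 * b2) ⊗ 1)).
    move=> lG; rewrite /smash_coact /smash_mul.
    lpush; lat ltac:(rewrite sigmaE; reflexivity); lpush; lcu.
    by sw_strip.
  have E1 := aux (fun z => sigma ((z : B) ⊗ ((t ⊗ 1) : B))) r s.
  have E2 := aux (fun z => sigma (((r ⊗ 1) : B) ⊗ (z : B))) s t.
  transitivity (\tsum_(a1 ⊗ a2 <- bcomul R r) \tsum_(b1 ⊗ b2 <- bcomul R s)
    \tsum_(m ⊗ a20 <- coact R a2) (pi (a1 ⊗ act R m b1) *:
      (sigma ((((a20 * b2) ⊗ 1) : B) ⊗ ((t ⊗ 1) : B)) : k^o))).
    do 3 (apply: eq_tlift => ? ?); by rewrite [pi (_ * _ ⊗ t)]restrictE.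
  rewrite -E1; last by slin.
  refine (eq_trans (scoc _ _ _) (eq_trans (E2 _) _)); first by slin.
  do 3 (apply: eq_tlift => ? ?); by rewrite [pi (r ⊗ _)]restrictE.
Qed.

End ZprimeForm.

(** * The two bijections *)

Section Iso.
Variables (k : fieldType).

Lemma lin_inv (V W : lmodType k) (f : V -> W) (g : W -> V) :
  linear f -> cancel f g -> cancel g f -> linear g.
Proof. by move=> lf fg gf a x y; apply: (can_inj fg); rewrite lf !gf. Qed.

Lemma isoB_refl (B : bialgData k) (E : cleftB B) : isoB E E.
Proof.
exists id; split=> //; first by split=> //; exists id.
by move=> x; symmetry; apply: tlift_id.
Qed.

Lemma isoB_trans (B : bialgData k) (E E' E'' : cleftB B) :
  isoB E E' -> isoB E' E'' -> isoB E E''.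
Proof.
move=> [f [[lf bf] [fm f1] fc fs]] [g [[lg bg] [gm g1] gc gs]].
exists (fun x => g (f x)); split.
- by split; [exact: lin_comp|exact: bij_comp].
- by split=> [x y|]; rewrite ?fm ?gm ?f1.
- by move=> x; rewrite gc fc; lpush.
- by move=> b; rewrite fs gs.
Qed.

Lemma isoB_sym (B : bialgData k) (E E' : cleftB B) : isoB E E' -> isoB E' E.
Proof.
move=> [f [[lf [g fg gf]] [fm f1] fc fs]].
have lg := lin_inv lf fg gf.
exists g; split.
- by split=> //; exists f.
- by split=> [x y|]; apply: (can_inj fg); rewrite ?fm ?gf.
- move=> y; rewrite -{2}(gf y) fc; rpush; rewrite -[LHS]tlift_id.
  by apply: eq_tlift => e b; rewrite fg.
- by move=> b; apply: (can_inj fg); rewrite gf fs.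
Qed.

Lemma isoR_refl (H : hopfAlg k) (R : ydHopfAlg H) (E : cleftR R) : isoR E E.
Proof.
exists id; split=> //; first by split=> //; exists id.
by move=> x; symmetry; apply: tlift_id.
Qed.

Lemma isoR_trans (H : hopfAlg k) (R : ydHopfAlg H) (E E' E'' : cleftR R) :
  isoR E E' -> isoR E' E'' -> isoR E E''.
Proof.
move=> [f [[lf bf] [fm f1] fa fc fs]] [g [[lg bg] [gm g1] ga gc gs]].
exists (fun x => g (f x)); split.
- by split; [exact: lin_comp|exact: bij_comp].
- by split=> [x y|]; rewrite ?fm ?gm ?f1.
- by move=> h x; rewrite fa ga.
- by move=> x; rewrite gc fc; lpush.
- by move=> b; rewrite fs gs.
Qed.

Lemma isoR_sym (H : hopfAlg k) (R : ydHopfAlg H) (E E' : cleftR R) :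
  isoR E E' -> isoR E' E.
Proof.
move=> [f [[lf [g fg gf]] [fm f1] fa fc fs]].
have lg := lin_inv lf fg gf.
exists g; split.
- by split=> //; exists f.
- by split=> [x y|]; apply: (can_inj fg); rewrite ?fm ?gf.
- by move=> h x; apply: (can_inj fg); rewrite fa !gf.
- move=> y; rewrite -{2}(gf y) fc; rpush; rewrite -[LHS]tlift_id.
  by apply: eq_tlift => e b; rewrite fg.
- by move=> b; apply: (can_inj fg); rewrite gf fs.
Qed.

Lemma iso_class_eq (T : Type) (iso : T -> T -> Prop) (x y : T) :
  (forall x y, iso x y -> iso y x) ->
  (forall x y z, iso x y -> iso y z -> iso x z) ->
  iso x y -> iso_class iso x = iso_class iso y.
Proof.
move=> s t xy; apply: functional_extensionality_dep => z.
apply: propositional_extensionality.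
by split=> h; [apply: t h; apply: s|apply: t h].
Qed.

End Iso.

Lemma and3_proj1 (P Q S : Prop) : [/\ P, Q & S] -> P.
Proof. by case. Qed.

(** * Isomorphisms between smash products *)

Section SmashIso.
Variables (k : fieldType) (H : hopfAlg k) (R : ydHopfAlg H).
Implicit Types E : cleftR R.

Lemma smash_iso E E' : is_cleftR E -> is_cleftR E' ->
  isoR E E' -> isoB (smash E) (smash E').
Proof.
move=> cE cE' [f [[lf [g fg gf]] [fm f1] fa fc fs]].
have lg := lin_inv lf fg gf.
exists (fun x => \tsum_(e ⊗ h <- x) (f e ⊗ h)); split.
- split; first by slin.
  exists (fun x => \tsum_(e ⊗ h <- x) (g e ⊗ h)) => x; lpush; rewrite -[RHS]tlift_id;
    by apply: eq_tlift => e h; rewrite ?fg ?gf.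
- have bm : bilin (@cR_mul _ _ _ E) by case: cE => -[[]].
  have ba : bilin (@cR_act _ _ _ E) by case: cE => -[_ []].
  have bm' : bilin (@cR_mul _ _ _ E') by case: cE' => -[[]].
  have ba' : bilin (@cR_act _ _ _ E') by case: cE' => -[_ []].
  split=> [x y|]; last by rewrite /= tliftE ?f1 //; sbilin.
  rewrite /= /smash_mul; lpush; rpush; sw_strip.
  by rewrite fm fa.
- have lc : linear (@cR_coact _ _ _ E) by case: cE => _ [[]].
  have lc' : linear (@cR_coact _ _ _ E') by case: cE' => _ [[]].
  move=> x; rewrite /= /smash_coact; lpush; rpush.
  by lat ltac:(rewrite fc; reflexivity); lpush; sw_strip.
- have ls : linear (@cR_sec _ _ _ E) by case: cE => _ _ [].
  by move=> x; rewrite /=; lpush; apply: eq_tlift => r h; rewrite fs.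
Qed.

(** γ ⊗ id is onto by the result over R # H, and id ⊗ ε carries this down to γ. *)
Lemma smash_section_surj E : is_cleftR E -> forall e, exists r, cR_sec E r = e.
Proof.
move=> cE e; have [cS _] := smash_cleft cE.
have [om [_ _ _ [f [[_ [g fg gf]] _ _ fs]]]] := cleftB_form (boson_bialgebra R) cS.
have ls : linear (@cR_sec _ _ _ E) by case: cE => _ _ [].
exists (\tsum_(r ⊗ h <- (g (e ⊗ 1) : (R ⊗ H)%type)) (counit h *: r)).
have := fs (g (e ⊗ 1)); rewrite gf /= => /(congr1 (tlift (fun e h => counit h *: e))).
have b : bilin (fun (e : E) (h : H) => counit h *: e) by sbilin.
rewrite tliftE // counit1 scale1r => he; rewrite [RHS]he.
by lpush; rpush.
Qed.

(** Compatibility with the sections fixes F on every γ(r) ⊗ h, and γ is onto. So H-linearity and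
    colinearity of f come from those of the two sections, and only the algebra structure is read off
    F. *)
Lemma smash_iso_inv E E' : is_cleftR E -> is_cleftR E' ->
  isoB (smash E) (smash E') -> isoR E E'.
Proof.
move=> cE cE' [F [[lF [G FG GF]] [Fm F1] Fc Fs]].
have bm : bilin (@cR_mul _ _ _ E) by case: cE => -[[]].
have bm' : bilin (@cR_mul _ _ _ E') by case: cE' => -[[]].
have b (D : cleftR R) : bilin (fun (e : D) (h : H) => counit h *: e) by sbilin.
pose f (e : E) : E' :=
  \tsum_(e' ⊗ h <- (F (e ⊗ 1) : (E' ⊗ H)%type)) (counit h *: e').
have Fgam r h : F (cR_sec E r ⊗ h) = cR_sec E' r ⊗ h.
  have ls : linear (@cR_sec _ _ _ E) by case: cE => _ _ [].
  have ls' : linear (@cR_sec _ _ _ E') by case: cE' => _ _ [].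
  have := Fs (r ⊗ h); rewrite /= !tliftE //; sbilin.
have fgam r : f (cR_sec E r) = cR_sec E' r.
  by rewrite /f Fgam tliftE // counit1 scale1r.
have Fe e h : F (e ⊗ h) = f e ⊗ h.
  by have [r <-] := smash_section_surj cE e; rewrite Fgam fgam.
have inj1 (D : cleftR R) (d d' : D) : d ⊗ (1 : H) = d' ⊗ 1 -> d = d'.
  move=> /(congr1 (tlift (fun e h => counit h *: e))).
  by rewrite !tliftE // counit1 !scale1r.
have lf : linear f by rewrite /f; slin.
exists f; split.
- split=> //.
  have finj : injective f.
    move=> e e' h; apply: inj1; apply: (can_inj FG); by rewrite !Fe h.
  have fsurj e' : exists e, f e = e'.
    by have [r <-] := smash_section_surj cE' e'; exists (cR_sec E r).
  exists (fun e' => projT1 (cid (fsurj e'))) => e; last exact: projT2 (cid (fsurj e)).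
  by apply: finj; exact: projT2 (cid (fsurj (f e))).
- split=> [x y|].
    apply: inj1; have := Fm (x ⊗ 1) (y ⊗ 1); rewrite /= !Fe.
    by rewrite (smash_mul_l (and3_proj1 cE)) (smash_mul_l (and3_proj1 cE')) Fe.
  apply: inj1; rewrite -Fe; exact: F1.
- move=> h e; have [r <-] := smash_section_surj cE e.
  have sa g : cR_sec E (act R h g) = cR_act h (cR_sec E g) by case: cE => _ _ [].
  have sa' g : cR_sec E' (act R h g) = cR_act h (cR_sec E' g) by case: cE' => _ _ [].
  by rewrite -sa !fgam sa'.
- move=> e; have [r <-] := smash_section_surj cE e.
  have sc g : cR_coact (cR_sec E g) =
      \tsum_(r1 ⊗ r2 <- bcomul R g) (cR_sec E r1 ⊗ r2).
    by case: cE => _ _ [].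
  have sc' g : cR_coact (cR_sec E' g) =
      \tsum_(r1 ⊗ r2 <- bcomul R g) (cR_sec E' r1 ⊗ r2).
    by case: cE' => _ _ [].
  rewrite fgam sc sc'; rpush.
  by apply: eq_tlift => r1 r2; rewrite fgam.
- exact: fgam.
Qed.

End SmashIso.

(** * The bijection between cocycles *)

Section Phi.
Variables (k : fieldType) (H : hopfAlg k) (R : ydHopfAlg H).
Local Notation B := (boson R).

Definition Phi (pi : (R ⊗ R)%type -> k) (t : (B ⊗ B)%type) : k :=
  \tsum_(x ⊗ y <- t) \tsum_(r ⊗ h <- (x : (R ⊗ H)%type))
    \tsum_(r' ⊗ h' <- (y : (R ⊗ H)%type)) (pi (r ⊗ act R h r') * counit h').

Lemma Phi_bilin pi : scalar pi -> bilin (fun x y : B =>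
  \tsum_(r ⊗ h <- (x : (R ⊗ H)%type)) \tsum_(r' ⊗ h' <- (y : (R ⊗ H)%type))
   (pi (r ⊗ act R h r') * counit h') : k^o).
Proof. by move=> /linear_form lp; sbilin. Qed.

Lemma Phi_scalar pi : scalar pi -> scalar (Phi pi).
Proof. by move=> /Phi_bilin h; apply: (tlift_linear h). Qed.

Lemma PhiE pi r h r' h' : scalar pi ->
  Phi pi (((r ⊗ h) : B) ⊗ ((r' ⊗ h') : B)) = pi (r ⊗ act R h r') * counit h'.
Proof.
move=> sp; have lp := linear_form sp; rewrite /Phi.
refine (eq_trans (tliftE (Phi_bilin sp) _ _) _).
refine (eq_trans (@tliftE k R H k^o (fun r h => \tsum_(r' ⊗ h' <- (r' ⊗ h'))
   (pi (r ⊗ act R h r') * counit h')) _ _ _) _); first by sbilin.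
refine (@tliftE k R H k^o (fun r' h' => pi (r ⊗ act R h r') * counit h') _ _ _).
by sbilin.
Qed.

Lemma Phi_smash pi : ZR pi ->
  ZB (Phi pi) /\ isoB (twistB (Phi pi)) (smash (twistR pi)).
Proof.
move=> zp; have sp : scalar pi by case: zp.
have lp := linear_form sp.
have [cS _] := smash_cleft (ZR_twistR_cleft zp).
have [om [som os zs iso]] := cleftB_form (boson_bialgebra R) cS.
have sE x : cB_sec (smash (twistR pi)) x = x by apply: tlift_id.
(* The section of (k #_π R) # H is the identity, so ω is the counit of R # H. The cocycle is
   therefore the counit of the product, and ε(a ·_π b) = π(a, b). *)
suff -> : Phi pi = cleft_cocycle om by [].
apply: functional_extensionality_dep.
apply: boson_form_ext; first exact: Phi_scalar.
  by case: zs.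
move=> r h r' h'; rewrite PhiE //.
have lom := linear_form som.
have bs : bilin (fun x y : smash (twistR pi) => om (cB_mul x y) : k^o).
  have bm := smash_mul_bilin (and3_proj1 (ZR_twistR_cleft zp)).
  by split=> ?; slin.
have -> : cleft_cocycle om (((r ⊗ h) : B) ⊗ ((r' ⊗ h') : B)) =
    om (@cB_mul k B (smash (twistR pi)) (r ⊗ h) (r' ⊗ h')).
  rewrite /cleft_cocycle; refine (eq_trans _ (tliftE bs _ _)).
  by apply: eq_tlift => x y; rewrite !sE.
rewrite -[cB_mul _ _]sE os.
change (pi (r ⊗ act R h r') * counit h' =
  @tlift k R H k^o (fun r h => bcounit R r * counit h)
    (@smash_mul k H R (mulpi pi) (act R) (r ⊗ h) (r' ⊗ h'))).
have bm : bilin (mulpi pi) := mulpi_bilin sp.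
have em a b : bcounit R (mulpi pi a b) = pi (a ⊗ b).
  refine (_ : _ = _ :> k^o); rewrite /mulpi /twist; lpush.
  transitivity (\tsum_(a1 ⊗ a2 <- bcomul R a) \tsum_(b1 ⊗ b2 <- bcomul R b)
     \tsum_(m ⊗ a20 <- coact R a2)
     (bcounit R a20 *: (bcounit R b2 *: (pi (a1 ⊗ act R m b1) : k^o)))).
    do 3 (apply: eq_tlift => ? ?); rewrite /GRing.scale /=; ring.
  by lcu; lpush; lcu.
refine (_ : _ = _ :> k^o).
rewrite /smash_mul; symmetry; lpush.
transitivity (\tsum_(h1 ⊗ h2 <- comul h) (counit h2 *: (counit h' *:
   (pi (r ⊗ act R h1 r') : k^o)))).
  by apply: eq_tlift => h1 h2; rewrite em /GRing.scale /=; ring.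
by lcu; rewrite [RHS]mulrC.
Qed.

Lemma Phi_Z' pi : ZR pi -> Z'boson (Phi pi).
Proof.
move=> zp; have sp : scalar pi by case: zp.
split; first by case: (Phi_smash zp).
by move=> r r' h h'; rewrite !PhiE // act1 counit1 mulr1.
Qed.

Lemma Phi_restrict sigma : Z'boson sigma -> Phi (restrict sigma) = sigma.
Proof.
move=> zs; have ss : scalar sigma by case: zs => -[].
have sp := restrict_scalar ss.
apply: functional_extensionality_dep; apply: boson_form_ext => //.
  exact: Phi_scalar.
by move=> r h r' h'; rewrite PhiE // (sigmaE zs).
Qed.

Lemma Phi_bij : bij_between (@ZR k H R) (@Z'boson k H R) Phi.
Proof.
split; first exact: Phi_Z'.
  move=> pi pi' zp zp' e.
  have sp : scalar pi by case: zp.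
  have sp' : scalar pi' by case: zp'.
  apply: functional_extensionality_dep.
  apply: (@lin_tens_ext k R R k^o) => // r s.
  have := congr1 (fun f => f (((r ⊗ 1) : B) ⊗ ((s ⊗ 1) : B))) e.
  by rewrite !PhiE // act1 counit1 !mulr1.
move=> sigma zs; exists (restrict sigma); first exact: restrict_ZR.
exact: Phi_restrict.
Qed.

(** Balancedness splits δ(r ⊗ h) as δ(r ⊗ 1) δ(1 ⊗ h), and δ(1 ⊗ h) is absorbed by the factor on its
    right. There h acts on r', and what remains at the far right is removed by ω. *)
Lemma balanced_Z' (E : cleftB B) (om : E -> k) : is_cleftB E -> is_H_balanced E ->
  scalar om -> (forall b, om (cB_sec E b) = b_counit b) ->
  (forall x, exists b, cB_sec E b = x) -> ZB (cleft_cocycle om) ->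
  Z'boson (cleft_cocycle om).
Proof.
move=> cE bE som os surj zE; split=> // r r' h h'.
have lom := linear_form som.
have hA : is_algebra (@cB_mul _ _ E) (cB_one E) by case: cE => -[].
have hB := boson_bialgebra R.
have [bm mA m1 m1' _] := hA.
have [_ [bB mBA mB1 mB1' _] _ _ [eM _]] := hB.
have ld : linear (@cB_sec _ _ E) by case: cE => _ [].
have d1 : cB_sec E (1 ⊗ 1 : B) = cB_one E by case: cE => _ [].
have sE x y : cleft_cocycle om (x ⊗ y) = om (cB_mul (cB_sec E x) (cB_sec E y)).
  exact: cleft_cocycleE.
have dl g a g' : cB_sec E (b_mul (inH R g) ((a ⊗ g') : B)) =
    cB_mul (cB_sec E (1 ⊗ g)) (cB_sec E (a ⊗ g')).
  have := bE a g g' 1; rewrite d1 m1' => <-; congr cB_sec.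
  exact: esym (mB1' _).
have dr a g g' : cB_sec E (a ⊗ (g * g') : B) =
    cB_mul (cB_sec E (a ⊗ g)) (cB_sec E (1 ⊗ g')).
  have := bE a 1 g g'; rewrite d1 m1 => <-; congr cB_sec.
  rewrite -mul_inHr; congr (b_mul _ _); exact: esym (mB1 _).
(* As z is a value of δ, its product with δ(1 ⊗ g) is again one, and ω δ = ε is multiplicative. *)
have omr z g : om (cB_mul z (cB_sec E (1 ⊗ g))) = om z * counit g.
  have [t <-] := surj z; move: t.
  refine (@lin_tens_ext k R H k^o
    (fun t : B => om (cB_mul (cB_sec E t) (cB_sec E (1 ⊗ g : B))))
    (fun t : B => om (cB_sec E t) * counit g) _ _ _); try slin.
  move=> a g'; rewrite -dr !os.
  have ce c d : b_counit (c ⊗ d : B) = bcounit R c * counit d.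
    change (@tlift k R H k^o (fun r h => bcounit R r * counit h) (c ⊗ d) =
      bcounit R c * counit d).
    by lpush.
  by rewrite !ce counitM mulrA.
rewrite !sE -{1}(mul1r h) dr -mA -dl mul_inHl.
have ld' : linear (@cB_sec _ _ E : (R ⊗ H)%type -> E) := ld.
refine (_ : _ = _ :> k^o); lpush.
transitivity (\tsum_(h1 ⊗ h2 <- comul h) (counit h2 *: (counit h' *:
  (om (cB_mul (cB_sec E (r ⊗ 1 : B)) (cB_sec E (act R h1 r' ⊗ 1 : B))) : k^o)))).
  apply: eq_tlift => h1 h2.
  by rewrite -[h2 * h']mul1r dr mA omr counitM /GRing.scale /=; ring.
by lcu; rewrite [RHS]mulrC.
Qed.

End Phi.

(** * The bijection between cleft objects *)

Section Psi.
Variables (k : fieldType) (H : hopfAlg k) (R : ydHopfAlg H).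

(** A union over all representatives instead of a chosen one; on the class of a cleft object it is a
    single class, by [smash_iso]. Cleftness is requested of the representative because [iso_class]
    records only isomorphism. *)
Definition Psi (C : cleftR R -> Prop) : cleftB (boson R) -> Prop :=
  fun F => exists2 E, C E /\ is_cleftR E & isoB (smash E) F.

Lemma Psi_class E : is_cleftR E ->
  Psi (iso_class (@isoR k H R) E) = iso_class (@isoB k (boson R)) (smash E).
Proof.
move=> cE; apply: functional_extensionality_dep => F.
apply: propositional_extensionality; split=> [[E' [EE' cE'] iso]|iso].
  exact: isoB_trans (smash_iso cE cE' EE') iso.
by exists E => //; split=> //; exact: isoR_refl.
Qed.

Lemma isoB_section_surj (B : bialgData k) (s : (B ⊗ B)%type -> k) (E : cleftB B) :
  isoB (twistB s) E -> forall x, exists b, cB_sec E b = x.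
Proof. by move=> [f [[_ [g _ gf]] _ _ fs]] x; exists (g x); rewrite -fs gf. Qed.

Lemma Psi_bij : bij_between (@CR k H R) (@C'boson k H R) Psi.
Proof.
split.
- move=> C [E cE ->]; rewrite Psi_class //.
  by exists (smash E) => //; exact: smash_cleft.
- move=> C C' [E cE ->] [E' cE' ->]; rewrite !Psi_class // => h.
  apply: iso_class_eq; [exact: isoR_sym|exact: isoR_trans|].
  apply: smash_iso_inv => //.
  have : iso_class (@isoB k (boson R)) (smash E') (smash E') by exact: isoB_refl.
  by rewrite -h.
- move=> D [F [cF bF] ->].
  have [om [som os zs iso]] := cleftB_form (boson_bialgebra R) cF.
  have z's := balanced_Z' cF bF som os (isoB_section_surj iso) zs.
  (* The preimage is k #_π R for this restriction π: its smash product has cocycle Φ(π), which is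
     the cocycle of [F]. *)
  have zp := restrict_ZR z's.
  have cE := ZR_twistR_cleft zp.
  exists (iso_class (@isoR k H R) (twistR (restrict (cleft_cocycle om)))).
    by exists (twistR (restrict (cleft_cocycle om))).
  rewrite Psi_class //.
  apply: iso_class_eq; [exact: isoB_sym|exact: isoB_trans|].
  have [_] := Phi_smash zp; rewrite Phi_restrict // => h.
  exact: isoB_trans (isoB_sym h) iso.
Qed.

End Psi.

Theorem proposition4p6 (k : fieldType) (H : hopfAlg k) (R : ydHopfAlg H) :
  exists (Phi : ((R ⊗ R)%type -> k) -> ((boson R ⊗ boson R)%type -> k))
         (Psi : (cleftR R -> Prop) -> (cleftB (boson R) -> Prop)),
    [/\ forall pi, ZR pi -> forall (r r' : R) (h h' : H),
          Phi pi (((r ⊗ h) : boson R) ⊗ ((r' ⊗ h') : boson R)) =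
          pi (r ⊗ act R h r') * counit h',
        bij_between (@ZR k H R) (@Z'boson k H R) Phi,
        forall E : cleftR R, is_cleftR E ->
          Psi (iso_class (@isoR k H R) E) =
          iso_class (@isoB k (boson R)) (smash E),
        bij_between (@CR k H R) (@C'boson k H R) Psi
      & forall pi, ZR pi ->
          CR (alphaR pi) /\ Psi (alphaR pi) = alphaB (Phi pi)].
Proof.
exists (@Phi k H R), (@Psi k H R); split.
- by move=> pi [sp _ _ _ _] r r' h h'; apply: PhiE.
- exact: Phi_bij.
- exact: Psi_class.
- exact: Psi_bij.
- move=> pi zp; have cE := ZR_twistR_cleft zp.
  split; first by exists (twistR pi).
  rewrite /alphaR Psi_class //; symmetry.
  apply: iso_class_eq; [exact: isoB_sym|exact: isoB_trans|].
  by case: (Phi_smash zp).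
Qed.
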